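(* Consider the closed-loop power-network/bidding system $\dot x=F(x)=f(x)+g(x)+h(x)$ on $\mathbb R^{4n}$ defined in the context, with an equilibrium $\bar x=\operatorname{col}(\bar\varphi,\bar\omega,\bar b,\bar P_g,\bar\lambda)$ such that $\bar\eta:=D^TD_t^{\dagger T}\bar\varphi\in(-\frac\pi2,\frac\pi2)^m$. Let $\|\bar\eta\|_\infty<\gamma<\frac\pi2$, $\Omega=\{x\in\mathbb R^{4n}: D^TD_t^{\dagger T}\varphi\in[-\gamma,\gamma]^m\}$, $B\in\mathbb R^{4n\times q}$, and let $\varepsilon\in\mathbb R^4_{>0}$ and $\alpha,\chi,c_1,c_2>0$ be such that the function $W_\varepsilon$ of the context satisfies, for all $x\in\Omega$ and all $d\in\mathbb R^q$ with $\|d\|\le\chi\|x-\bar x\|$, $$\tfrac12c_1\|x-\bar x\|^2\le W_\varepsilon(x)\le\tfrac12c_2\|x-\bar x\|^2,\qquad(\nabla W_\varepsilon(x))^T(F(x)+Bd)\le-\alpha\|x-\bar x\|^2.$$ Let $L_f,L_g,L_h,L_W>0$ be global Lipschitz constants of $f,g,h,\nabla W_\varepsilon$ respectively, let $L:=L_f+L_g+L_h$, let $0<\beta<\alpha$, and define $$\bar\xi:=\frac1{L_f+L_g}\log\Bigl(1+\frac{\beta(L_f+L_g)}{L(L_WL_h+\beta)}\Bigr),$$ $$\bar\zeta:=\frac1{L_f}\log\Bigl(1+\frac{L_f(\alpha-\beta)}{L_g(LL_W+\alpha)+(\alpha-\beta)(L_f+L_g)}\Bigr).$$ Let $\{\{t_k^l\}_{k=0}^{N_l}\}_{l=0}^\infty$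 be a time sequence with $N_l\in\mathbb Z_{\ge1}$, $t_0^0=0$, $t_k^l>t_{k-1}^l$ and $t_0^{l+1}=t_{N_l}^l$ for all $l\in\mathbb Z_{\ge0}$, $k\in\{1,\dots,N_l\}$. Assume that for some $\underline\zeta\in(0,\bar\zeta)$ and $\underline\xi\in(0,\bar\xi)$, $$\underline\xi\le t_0^{l+1}-t_0^l\le\bar\xi\quad\text{and}\quad\underline\zeta\le t_k^l-t_{k-1}^l\le\bar\zeta$$ for all $l\in\mathbb Z_{\ge0}$ and $k\in\{1,\dots,N_l\}$. Then $\bar x$ is locally asymptotically stable under the time-triggered system $$\dot x(t)=f(x(t))+g(x(t_k^l))+h(x(t_0^l)),\qquad t\in[t_k^l,t_{k+1}^l),\ l\in\mathbb Z_{\ge0},\ k\in\{0,\dots,N_l-1\}.$$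
   Context: Network. Let $\mathcal G=(\mathcal V,\mathcal E)$ be a connected undirected graph with nodes $\mathcal V=\{1,\dots,n\}$ and $m$ edges labeled $1,\dots,m$. Each edge has its ends arbitrarily labeled $+$ and $-$; $D\in\mathbb R^{n\times m}$ is the incidence matrix ($D_{ik}=+1$ if $i$ is the positive end of edge $k$, $-1$ if $i$ is the negative end, $0$ otherwise). Let $D_t\in\mathbb R^{n\times(n-1)}$ be the incidence matrix of a spanning tree of $\mathcal G$ and $D_t^\dagger=(D_t^TD_t)^{-1}D_t^T$ its Moore-Penrose inverse; $D_t^{\dagger T}$ denotes its transpose. $\mathbf 1$ is the all-ones vector, and $\|v\|_A^2:=v^TAv$; $\|\cdot\|$ is the Euclidean norm. Parameters. $\Gamma=\operatorname{diag}\{\gamma_1,\dots,\gamma_m\}$ with $\gamma_k=B_{ij}V_iV_j>0$ for edge $k$ between nodes $i,j$ (voltage magnitudes $V_i>0$, line susceptance constants $B_{ij}>0$). $M,A\in\mathbb R^{n\times n}$ are diagonal with positive diagonal entries (inertia and damping). $P_d\in\mathbb R^n$ is a constant load vector. $Q=\operatorname{diag}\{q_1,\dots,q_n\}$ with $q_i>0$, $c=\operatorname{col}(c_1,\dots,c_n)$ with $c_i\ge0$. $T_b,T_g\in\mathbb R^{n\times n}$ are diagonal positive definite, and $\rho,\sigma,\tau_\lambda>0$ are scalars. Potential. $U(\varphi)=-\mathbf 1^T\Gamma\cos(D^TD_t^{\dagger T}\varphi)$ for $\varphi\in\mathbb R^{n-1}$, with $\cos$ applied componentwise. Vector fields. The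 state is $x=\operatorname{col}(\varphi,\omega,b,P_g,\lambda)\in\mathbb R^{n-1}\times\mathbb R^n\times\mathbb R^n\times\mathbb R^n\times\mathbb R=\mathbb R^{4n}$, and $$f(x)=\operatorname{col}\big(D_t^T\omega,\,-M^{-1}(D_t\nabla U(\varphi)+A\omega+P_d),\,0,\,0,\,0\big),$$ $$g(x)=\operatorname{col}\big(0,\,0,\,T_b^{-1}(P_g-Q^{-1}b+Q^{-1}c),\,T_g^{-1}(\mathbf 1\lambda-b-\sigma^2\omega+\rho\mathbf 1\mathbf 1^T(P_d-P_g)),\,\tau_\lambda^{-1}\mathbf 1^T(P_d-P_g)\big),$$ $$h(x)=\operatorname{col}(0,\,M^{-1}P_g,\,0,\,0,\,0),$$ $F=f+g+h$. These maps are globally Lipschitz. It is a standing assumption that an equilibrium $\bar x$ of $\dot x=F(x)$ with $D^TD_t^{\dagger T}\bar\varphi\in(-\frac\pi2,\frac\pi2)^m$ exists (necessarily $\bar\omega=0$). Functions $V$ and $W_\varepsilon$. With $\varepsilon=\operatorname{col}(\varepsilon_0,\varepsilon_1,\varepsilon_2,\varepsilon_3)$, $$V(x)=U(\varphi)-(\varphi-\bar\varphi)^T\nabla U(\bar\varphi)-U(\bar\varphi)+\tfrac12\omega^TM\omega+\tfrac1{2\sigma^2}\big(\|b-\bar b\|_{T_b}^2+\|P_g-\bar P_g\|_{T_g}^2+\tau_\lambda(\lambda-\bar\lambda)^2\big),$$ $$W_\varepsilon(x)=V(x)+\varepsilon_0\varepsilon_1(\varphi-\bar\varphi)^TD_t^{\dagger}M\omega-\tfrac{\varepsilon_0\varepsilon_2}{\sigma^2}(b-\bar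 b)^TT_g(P_g-\bar P_g)-\tfrac{\varepsilon_0\varepsilon_3}{\sigma^2}(\lambda-\bar\lambda)\mathbf 1^TT_g(P_g-\bar P_g).$$ Solutions of the time-triggered system are understood in the Carathéodory sense (absolutely continuous on compact intervals, satisfying the equation for almost all $t\ge0$), starting at $t_0^0=0$. Local asymptotic stability of $\bar x$ means: for every $r>0$ there is $\delta>0$ such that $\|x(0)-\bar x\|<\delta$ implies $\|x(t)-\bar x\|<r$ for all $t\ge0$; and there is $\delta_0>0$ such that $\|x(0)-\bar x\|<\delta_0$ implies $x(t)\to\bar x$ as $t\to\infty$. *)

(* Defs.v *)
From HB Require Import structures.
From mathcomp Require Import all_boot all_order all_algebra.
From mathcomp Require Import all_classical all_reals all_analysis.
Set Implicit Arguments.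
Unset Strict Implicit.
Unset Printing Implicit Defensive.
Import Order.TTheory GRing.Theory Num.Theory.
Import numFieldNormedType.Exports.
Local Open Scope classical_set_scope.
Local Open Scope ring_scope.

Section Graphs.
Variables n p : nat.

Definition connected_graph (e : rel 'I_n) : Prop :=
  forall i j, connect e i j.

Definition acyclic_graph (e : rel 'I_n) : Prop :=
  forall s : seq 'I_n, (2 < size s)%N -> ~ ucycle e s.

Definition spanning_tree (e t : rel 'I_n) : Prop :=
  [/\ symmetric t, subrel t e, connected_graph t & acyclic_graph t].

(* The undirected edges of [e] are numbered bijectively by ['I_p]; edge [k] has
   positive end [pos k] and negative end [neg k]. *)
Definition edge_labelling (e : rel 'I_n) (pos neg : 'I_p -> 'I_n) : Prop :=
  (forall k, e (pos k) (neg k)) /\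
  (forall i j, e i j -> exists! k,
     (pos k = i /\ neg k = j) \/ (pos k = j /\ neg k = i)).

Definition incidence (R : realType) (pos neg : 'I_p -> 'I_n) : 'M[R]_(n, p) :=
  \matrix_(i, k) (if i == pos k then 1 else if i == neg k then -1 else 0).

End Graphs.

Record network (n m : nat) := Network {
  adj : rel 'I_n;
  adj_sym : symmetric adj;
  adj_irr : irreflexive adj;
  adj_connected : connected_graph adj;
  epos : 'I_m -> 'I_n;
  eneg : 'I_m -> 'I_n;
  edgesP : edge_labelling adj epos eneg;
  tree : rel 'I_n;
  treeP : spanning_tree adj tree;
  (* The orientation of the tree edges need not be the one chosen on the graph. *)
  tpos : 'I_n.-1 -> 'I_n;
  tneg : 'I_n.-1 -> 'I_n;
  tedgesP : edge_labelling tree tpos tneg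
}.

Section Euclidean.
Variable R : realType.

(* The library norm on matrices is the sup norm. *)
Definition enorm k (v : 'cV[R]_k) : R := Num.sqrt (\sum_i v i 0 ^+ 2).

Definition qform k (A : 'M[R]_k) (v : 'cV[R]_k) : R := (v^T *m A *m v) 0 0.

Definition posdef k (A : 'M[R]_k) : Prop :=
  A^T = A /\ (forall v : 'cV[R]_k, v != 0 -> 0 < qform A v).

Definition grad k (f : 'cV[R]_k -> R) (x : 'cV[R]_k) : 'cV[R]_k :=
  \col_i 'D_(delta_mx i 0) f x.

Definition lipschitz_const k l (L : R) (f : 'cV[R]_k -> 'cV[R]_l) : Prop :=
  forall x y, enorm (f x - f y) <= L * enorm (x - y).

Definition abs_continuous k (a b : R) (x : R -> 'cV[R]_k) : Prop :=
  forall e : R, 0 < e -> exists2 d : R, 0 < d &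
    forall s : seq (R * R),
      all (fun p => [&& a <= p.1, p.1 <= p.2 & p.2 <= b]) s ->
      pairwise (fun p q => (p.2 <= q.1) || (q.2 <= p.1)) s ->
      \sum_(p <- s) (p.2 - p.1) < d ->
      \sum_(p <- s) enorm (x p.2 - x p.1) < e.

End Euclidean.

Record bidding_network (R : realType) (n m : nat) := BiddingNetwork {
  net :> network n m;
  volt : 'cV[R]_n;
  volt_gt0 : forall i, 0 < volt i 0;
  susc : 'M[R]_n;
  susc_sym : susc^T = susc;
  susc_gt0 : forall i j, adj net i j -> 0 < susc i j;
  inertia : 'M[R]_n;
  inertia_diag : is_diag_mx inertia;
  inertia_gt0 : forall i, 0 < inertia i i;
  damping : 'M[R]_n;
  damping_diag : is_diag_mx damping;
  damping_gt0 : forall i, 0 < damping i i;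
  load : 'cV[R]_n;
  cost_quad : 'rV[R]_n;
  cost_quad_gt0 : forall i, 0 < cost_quad 0 i;
  cost_lin : 'cV[R]_n;
  cost_lin_ge0 : forall i, 0 <= cost_lin i 0;
  Tb : 'M[R]_n;
  Tb_diag : is_diag_mx Tb;
  Tb_posdef : posdef Tb;
  Tg : 'M[R]_n;
  Tg_diag : is_diag_mx Tg;
  Tg_posdef : posdef Tg;
  rho : R;
  rho_gt0 : 0 < rho;
  sigma : R;
  sigma_gt0 : 0 < sigma;
  tau_lambda : R;
  tau_lambda_gt0 : 0 < tau_lambda
}.

(* Equal to [4 * n] as soon as [0 < n]. *)
Notation sdim n := (n.-1 + (n + (n + (n + 1))))%N.

Section State.
Variables (R : realType) (n : nat).

Definition mkstate (phi : 'cV[R]_n.-1) (omega b Pg : 'cV[R]_n) (lambda : R) :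
    'cV[R]_(sdim n) :=
  col_mx phi (col_mx omega (col_mx b (col_mx Pg (const_mx lambda)))).

Definition st_phi (x : 'cV[R]_(sdim n)) : 'cV[R]_n.-1 := usubmx x.
Definition st_omega (x : 'cV[R]_(sdim n)) : 'cV[R]_n := usubmx (dsubmx x).
Definition st_b (x : 'cV[R]_(sdim n)) : 'cV[R]_n := usubmx (dsubmx (dsubmx x)).
Definition st_Pg (x : 'cV[R]_(sdim n)) : 'cV[R]_n :=
  usubmx (dsubmx (dsubmx (dsubmx x))).
Definition st_lambda (x : 'cV[R]_(sdim n)) : R :=
  dsubmx (dsubmx (dsubmx (dsubmx x))) 0 0.

End State.

Section Model.
Variables (R : realType) (n m : nat) (S : bidding_network R n m).
Implicit Types (x xbar : 'cV[R]_(sdim n)) (phi : 'cV[R]_n.-1).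

Definition Dmx : 'M[R]_(n, m) := incidence R (epos S) (eneg S).
Definition Dt : 'M[R]_(n, n.-1) := incidence R (tpos S) (tneg S).
Definition Dtdag : 'M[R]_(n.-1, n) := invmx (Dt^T *m Dt) *m Dt^T.

Definition Gam : 'M[R]_m :=
  diag_mx (\row_k (susc S (epos S k) (eneg S k) *
                   volt S (epos S k) 0 * volt S (eneg S k) 0)).
Definition Qmx : 'M[R]_n := diag_mx (cost_quad S).
Definition ones k : 'cV[R]_k := const_mx 1.

Definition edge_angle phi : 'cV[R]_m := Dmx^T *m Dtdag^T *m phi.

Definition potential phi : R := - ((ones m)^T *m Gam *m map_mx cos (edge_angle phi)) 0 0.

Definition imbalance x : R := ((ones n)^T *m (load S - st_Pg x)) 0 0.

Definition fvec x : 'cV[R]_(sdim n) :=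
  mkstate
    (Dt^T *m st_omega x)
    (- (invmx (inertia S) *m
        (Dt *m grad potential (st_phi x) + damping S *m st_omega x + load S)))
    0 0 0.

Definition gvec x : 'cV[R]_(sdim n) :=
  mkstate
    0
    0
    (invmx (Tb S) *m
       (st_Pg x - invmx Qmx *m st_b x + invmx Qmx *m cost_lin S))
    (invmx (Tg S) *m
       (st_lambda x *: ones n - st_b x - sigma S ^+ 2 *: st_omega x
        + (rho S * imbalance x) *: ones n))
    ((tau_lambda S)^-1 * imbalance x).

Definition hvec x : 'cV[R]_(sdim n) :=
  mkstate 0 (invmx (inertia S) *m st_Pg x) 0 0 0.

Definition Fvec x : 'cV[R]_(sdim n) := fvec x + gvec x + hvec x.

Definition Vfun xbar x : R :=
  potential (st_phi x) - ((st_phi x - st_phi xbar)^T *m grad potential (st_phi xbar)) 0 0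
  - potential (st_phi xbar)
  + 2^-1 * qform (inertia S) (st_omega x)
  + (2 * sigma S ^+ 2)^-1 *
    (qform (Tb S) (st_b x - st_b xbar) + qform (Tg S) (st_Pg x - st_Pg xbar)
     + tau_lambda S * (st_lambda x - st_lambda xbar) ^+ 2).

Definition Wfun (e0 e1 e2 e3 : R) xbar x : R :=
  Vfun xbar x
  + e0 * e1 *
    ((st_phi x - st_phi xbar)^T *m Dtdag *m inertia S *m st_omega x) 0 0
  - e0 * e2 / sigma S ^+ 2 *
    ((st_b x - st_b xbar)^T *m Tg S *m (st_Pg x - st_Pg xbar)) 0 0
  - e0 * e3 / sigma S ^+ 2 * (st_lambda x - st_lambda xbar) *
    ((ones n)^T *m Tg S *m (st_Pg x - st_Pg xbar)) 0 0.

Definition angle_domain (gamma : R) : set 'cV[R]_(sdim n) :=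
  [set x | forall k, - gamma <= edge_angle (st_phi x) k 0 <= gamma].

End Model.

Section TimeTriggered.
Variables (R : realType) (k : nat).
Implicit Types (f g h : 'cV[R]_k -> 'cV[R]_k) (N : nat -> nat).
Implicit Types (t : nat -> nat -> R) (x : R -> 'cV[R]_k).

Definition xi_bar (Lf Lg Lh LW beta : R) : R :=
  (Lf + Lg)^-1 *
  ln (1 + beta * (Lf + Lg) / ((Lf + Lg + Lh) * (LW * Lh + beta))).

Definition zeta_bar (Lf Lg Lh LW alpha beta : R) : R :=
  Lf^-1 *
  ln (1 + Lf * (alpha - beta) /
          (Lg * ((Lf + Lg + Lh) * LW + alpha) + (alpha - beta) * (Lf + Lg))).

(* [t l i] stands for the [i]-th instant of the [l]-th block; it is meaningful
   only for [i <= N l]. *)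
Definition time_sequence N t : Prop :=
  [/\ forall l, (1 <= N l)%N,
      t 0%N 0%N = 0,
      forall l i, (1 <= i <= N l)%N -> t l i.-1 < t l i
    & forall l, t l.+1 0%N = t l (N l)].

Definition tt_solution f g h N t x : Prop :=
  (forall T : R, 0 < T -> abs_continuous 0 T x) /\
  {ae @lebesgue_measure R, forall s : R, 0 <= s ->
     forall l i, (i < N l)%N -> t l i <= s < t l i.+1 ->
     is_derive s (1 : R) x (f (x s) + g (x (t l i)) + h (x (t l 0%N)))}.

Definition locally_asymptotically_stable
    (sol : (R -> 'cV[R]_k) -> Prop) (xbar : 'cV[R]_k) : Prop :=
  (forall r : R, 0 < r -> exists2 delta : R, 0 < delta &
     forall x, sol x -> enorm (x 0 - xbar) < delta ->
     forall s : R, 0 <= s -> enorm (x s - xbar) < r) /\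
  (exists2 delta0 : R, 0 < delta0 &
     forall x, sol x -> enorm (x 0 - xbar) < delta0 ->
     x s @[s --> +oo] --> xbar).

End TimeTriggered.

(* Main.v *)
Require Import Defs.
From HB Require Import structures.
From mathcomp Require Import all_boot all_order all_algebra.
From mathcomp Require Import all_classical all_reals all_analysis.
From mathcomp Require Import ring lra.
Import Order.TTheory GRing.Theory Num.Theory.
Import numFieldNormedType.Exports.
Local Open Scope classical_set_scope.
Local Open Scope ring_scope.

Set Implicit Arguments.
Unset Strict Implicit.
Unset Printing Implicit Defensive.

(** Put y = x - xbar and L = Lf + Lg + Lh.  On a block starting at t_0 a Gronwall
    estimate gives |x - x(t_0)| <= L |y(t_0)| (e^(a (t - t_0)) - 1) / a with
    a = Lf + Lg, and the bound xi_bar on the block length turns this into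
    LW Lh |x - x(t_0)| <= beta |y|.  On a step starting at t_k the bound zeta_bar
    similarly gives LW Lg |x - x(t_k)| <= (alpha - beta - mu) |y| with
    mu = (alpha - beta)^2 / (L LW + alpha) > 0: here the contribution of the
    outdated argument of h is compared with |y(t)| rather than |y(t_k)|, which is
    what makes the constant strict.  As grad W vanishes at xbar and is
    LW-Lipschitz, the two errors perturb the decay -alpha |y|^2 of W by at most
    (alpha - mu) |y|^2, so W decreases at rate mu |y|^2 along solutions.

    Solutions are differentiable only almost everywhere.  The passage from a sign
    condition on a derivative to monotonicity rests on a continuous induction in
    which the exceptional null set is crossed inside a small open cover. *)

(** * The Euclidean norm and its comparison with the sup norm *)

Section EuclideanNorm.
Context {R : realType} {k : nat}.
Implicit Types (u v w : 'cV[R]_k).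

Lemma enorm_ge0 v : 0 <= enorm v.
Proof. exact: sqrtr_ge0. Qed.

Lemma enorm_sqr v : enorm v ^+ 2 = \sum_i v i 0 ^+ 2.
Proof. by rewrite sqr_sqrtr// sumr_ge0// => i _; rewrite sqr_ge0. Qed.

Lemma enorm0 : enorm (0 : 'cV[R]_k) = 0.
Proof. by rewrite /enorm big1 ?sqrtr0// => i _; rewrite mxE expr0n. Qed.

Lemma enormN v : enorm (- v) = enorm v.
Proof. by rewrite /enorm; under eq_bigr do rewrite mxE sqrrN. Qed.

Lemma enormB u v : enorm (u - v) = enorm (v - u).
Proof. by rewrite -enormN opprB. Qed.

Lemma enormZ c v : enorm (c *: v) = `|c| * enorm v.
Proof.
rewrite /enorm; under eq_bigr do rewrite mxE exprMn.
by rewrite -mulr_sumr sqrtrM ?sqr_ge0// sqrtr_sqr.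
Qed.

Lemma dotmxE u v : (u^T *m v) 0 0 = \sum_i u i 0 * v i 0.
Proof. by rewrite mxE; apply: eq_bigr => i _; rewrite mxE. Qed.

Lemma enorm_eq0 v : enorm v = 0 -> v = 0.
Proof.
move=> v0; have : \sum_i v i 0 ^+ 2 = 0 by rewrite -enorm_sqr v0 expr0n.
move/psumr_eq0P => h; apply/matrixP => i j; rewrite ord1 mxE.
by apply/eqP; rewrite -sqrf_eq0 h// => l _; rewrite sqr_ge0.
Qed.

(** Cauchy-Schwarz: for nonzero vectors, the sum of the squares of
    [u i 0 * enorm v - v i 0 * enorm u] expands to [2 * (enorm u * enorm v)] times the difference of
    the two sides. *)
Lemma enorm_dot u v : (u^T *m v) 0 0 <= enorm u * enorm v.
Proof.
rewrite dotmxE; have [v0|v0] := eqVneq (enorm v) 0.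
  rewrite (enorm_eq0 v0) enorm0 mulr0 big1// => i _.
  by rewrite mxE mulr0.
have [u0|u0] := eqVneq (enorm u) 0.
  rewrite (enorm_eq0 u0) enorm0 mul0r big1// => i _.
  by rewrite mxE mul0r.
have up : 0 < enorm u by rewrite lt_neqAle eq_sym u0 enorm_ge0.
have vp : 0 < enorm v by rewrite lt_neqAle eq_sym v0 enorm_ge0.
have : 0 <= \sum_i (u i 0 * enorm v - v i 0 * enorm u) ^+ 2.
  by apply: sumr_ge0 => i _; rewrite sqr_ge0.
rewrite (eq_bigr (fun i => enorm v ^+ 2 * u i 0 ^+ 2 + enorm u ^+ 2 * v i 0 ^+ 2
     - (2 * (enorm u * enorm v)) * (u i 0 * v i 0))) => [|i _]; last by ring.
rewrite sumrB big_split /= -!mulr_sumr -!enorm_sqr => H.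
have uv : 0 < enorm u * enorm v by rewrite mulr_gt0.
rewrite -(ler_pM2l uv); nra.
Qed.

Lemma enormD u v : enorm (u + v) <= enorm u + enorm v.
Proof.
rewrite -(ler_pXn2r (n := 2))// ?nnegrE ?addr_ge0 ?enorm_ge0//.
rewrite enorm_sqr sqrrD !enorm_sqr.
under eq_bigr do rewrite mxE sqrrD.
rewrite !big_split /= !lerD2r lerD2l.
by have := enorm_dot u v; rewrite dotmxE; lra.
Qed.

Lemma ler_enormD u v a b : enorm u <= a -> enorm v <= b -> enorm (u + v) <= a + b.
Proof. by move=> ua vb; rewrite (le_trans (enormD _ _))// lerD. Qed.

Lemma enorm_distD u v w : enorm (u - w) <= enorm (u - v) + enorm (v - w).
Proof. by rewrite -[u - w](subrKA v) enormD. Qed.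

Lemma ler_enorm_dist u v : `|enorm u - enorm v| <= enorm (u - v).
Proof.
rewrite ler_norml; have := enormD (u - v) v; have := enormD (v - u) u.
by rewrite !subrK (enormB v u); lra.
Qed.

Lemma ler_coord_enorm v i : `|v i 0| <= enorm v.
Proof.
rewrite -sqrtr_sqr ler_sqrt; last by apply: sumr_ge0 => *; rewrite sqr_ge0.
rewrite (bigD1 i)//= lerDl sumr_ge0// => *; rewrite sqr_ge0//.
Qed.

Lemma norm_le_enorm v : `|v| <= enorm v.
Proof.
rewrite [leLHS]mx_normrE; apply: bigmax_le => [|[i j] _]; first exact: enorm_ge0.
by rewrite /= ord1 ler_coord_enorm.
Qed.

(** The sharp factor is the square root of [k]; [k.+1] is simpler and stays positive in dimension 0,
    so that it can be divided by. *)
Lemma enorm_le_norm v : enorm v <= k.+1%:R * `|v|.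
Proof.
have vi i : `|v i 0| <= `|v|.
  by rewrite [leRHS]mx_normrE; apply/bigmax_geP; right; exists (i, 0).
have k1 : (1 : R) <= k.+1%:R by rewrite ler1n.
rewrite -(ler_pXn2r (n := 2))// ?nnegrE ?mulr_ge0 ?enorm_ge0//.
rewrite enorm_sqr exprMn (@le_trans _ _ (\sum_(i < k) `|v| ^+ 2))//.
  apply: ler_sum => i _; rewrite -real_normK ?num_real//.
  by rewrite ler_pXn2r ?nnegrE.
rewrite sumr_const card_ord -[leLHS]mulr_natl ler_wpM2r ?sqr_ge0//.
rewrite (@le_trans _ _ k.+1%:R)// ?ler_nat//; rewrite ler_eXnr//.
Qed.

End EuclideanNorm.

(** * Monotonicity from an almost everywhere Dini bound *)

Section Growth.
Context {R : realType}.
Let mu : measure _ _ := @lebesgue_measure R.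

(** Outer regularity of Lebesgue measure, applied to a measurable null superset of [N]. *)
Lemma negligible_open_cover (N : set R) (d : R) :
  mu.-negligible N -> 0 < d ->
  exists G : set R, [/\ open G, N `<=` G & (mu G < d%:E)%E].
Proof.
move=> [A [mA A0 NA]] d0.
have [|G [oG AG GA]] := lebesgue_regularity_outer mA _ d0.
  by rewrite [X in (X < _)%E](_ : _ = 0%E) ?ltry.
exists G; split => //; first exact: subset_trans AG.
have mG := measurable_realfun.open_measurable oG.
rewrite -(setDUK AG) measureU//; last 2 first.
- exact: measurableD.
- by rewrite setDE setIC setIAC -setIA setIA; apply/seteqP; split => // z [[]].
by rewrite [X in (X + _)%E](_ : _ = 0%E) ?add0e.
Qed.

Let mu_itv (i : interval R) : mu [set` i] =
  (if (i.1 < i.2)%E then ((i.2 : \bar R) - i.1)%E else 0%E).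
Proof. exact: lebesgue_measure_itv. Qed.

(** A budget for the total length of the disjoint intervals laid inside the cover [G] up to [s]; the
    restriction to a bounded interval keeps it finite. *)
Definition len_upto (G : set R) (a s : R) : R := fine (mu (G `&` `[a, s])).

Lemma mu_upto_fin (G : set R) a s : open G -> mu (G `&` `[a, s]) \is a fin_num.
Proof.
move=> oG; rewrite ge0_fin_numE ?measure_ge0//.
have le : (mu (G `&` `[a, s]) <= mu `[a, s]%classic)%E.
  apply: le_measure; rewrite ?inE//.
  by apply: measurableI => //; exact: measurable_realfun.open_measurable.
rewrite (le_lt_trans le)//.
by rewrite mu_itv/=; case: ifPn => // _; rewrite -EFinB ltry.
Qed.

Lemma len_upto_mono (G : set R) a p q : open G -> p <= q ->
  len_upto G a p <= len_upto G a q.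
Proof.
move=> oG pq; rewrite /len_upto fine_le ?mu_upto_fin//.
apply: le_measure; rewrite ?inE//.
- by apply: measurableI => //; exact: measurable_realfun.open_measurable.
- by apply: measurableI => //; exact: measurable_realfun.open_measurable.
- apply: setIS => z /=; rewrite !in_itv/= => /andP[-> zp].
  exact: le_trans pq.
Qed.

Lemma len_upto_step (G : set R) a p q : open G -> a <= p -> p <= q ->
  (forall z, p <= z <= q -> G z) -> len_upto G a p + (q - p) <= len_upto G a q.
Proof.
move=> oG ap pq Gpq; have mG := measurable_realfun.open_measurable oG.
rewrite -lee_fin EFinD /len_upto !fineK ?mu_upto_fin//.
have -> : (q - p)%:E = mu `]p, q]%classic.
  rewrite mu_itv/= lte_fin; case: ifPn => [//|].
  by rewrite -leNgt => qp; rewrite (@le_anti _ _ p q) ?subrr// pq.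
have mGp : measurable (G `&` `[a, p]) by exact: measurableI.
rewrite -measureU//; last first.
  apply/seteqP; split => // z /= [[_]]; rewrite !in_itv/= => /andP[_ zp] /andP[pz _].
  by move: zp; rewrite leNgt pz.
apply: le_measure; rewrite ?inE//.
- exact: measurableU.
- exact: measurableI.
move=> z /= [[Gz]|]; rewrite !in_itv/= => /andP[z1 z2].
  by split => //; rewrite z1/= (le_trans z2).
split; first by apply: Gpq; rewrite (ltW z1).
by rewrite z2 andbT (le_trans ap)// ltW.
Qed.

(** The two side conditions of [abs_continuous], bundled so that a list of intervals can be extended
    step by step to the right. *)
Definition disjoint_pairs (a b : R) (s : seq (R * R)) :=
  all (fun p : R * R => [&& a <= p.1, p.1 <= p.2 & p.2 <= b]) s /\
  pairwise (fun p q : R * R => (p.2 <= q.1) || (q.2 <= p.1)) s.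

Lemma disjoint_pairs_cons a p q s : a <= p -> p <= q -> disjoint_pairs a p s ->
  disjoint_pairs a q ((p, q) :: s).
Proof.
move=> ap pq [s1 s2]; split => /=; first rewrite ap pq lexx/=.
  by apply: sub_all s1 => z /and3P[-> -> zp]/=; rewrite (le_trans zp).
rewrite s2 andbT; apply: sub_all s1 => z /and3P[_ _ ->].
by rewrite orbT.
Qed.

Lemma disjoint_pairsW a p q s : p <= q -> disjoint_pairs a p s ->
  disjoint_pairs a q s.
Proof.
move=> pq [s1 s2]; split => //.
by apply: sub_all s1 => z /and3P[-> -> zp]/=; rewrite (le_trans zp).
Qed.

(* Continuous induction along [a, b]: a point outside the exceptional set is
   crossed with the Dini bound, a point of the exceptional set inside a small
   open cover, whose contribution absolute continuity makes negligible. *)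
Lemma abs_cont_dini_le (phi : R -> R) (a b : R) : a <= b ->
  (forall e, 0 < e -> exists2 d, 0 < d & forall s, disjoint_pairs a b s ->
     \sum_(p <- s) (p.2 - p.1) < d -> \sum_(p <- s) `|phi p.2 - phi p.1| < e) ->
  {ae mu, forall s, a < s < b -> forall e, 0 < e ->
     \forall s' \near s, (phi s' - phi s) * (s' - s) <= e * (s' - s) ^+ 2} ->
  phi b <= phi a.
Proof.
move=> ab ac ae; apply/ler_addgt0Pr => e0 e0_gt0.
(* The error splits into a drift [e * (b - a)] from the Dini bound and a variation below [e] inside
   the cover; together they make [e0]. *)
pose e := e0 / (b - a + 1).
have ba : 0 < b - a + 1 by lra.
have e_gt0 : 0 < e by rewrite divr_gt0.
suff : phi b <= phi a + e * (b - a) + e.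
  by rewrite -addrA -[X in _ + X](_ : e0 = _)// /e -[X in _ + X]mulr1 -mulrDr divfK// gt_eqF.
have [d d0 acd] := ac _ e_gt0.
(* The endpoints join the exceptional set, since the Dini bound is assumed only strictly between [a]
   and [b]. *)
have [G [oG NG Gd]] : exists G : set R, [/\ open G,
    (~` [set s | a < s < b -> forall e, 0 < e ->
     \forall s' \near s, (phi s' - phi s) * (s' - s) <= e * (s' - s) ^+ 2])
     `|` ([set a] `|` [set b]) `<=` G & (mu G < d%:E)%E].
  apply: negligible_open_cover => //.
  apply: negligibleU; first exact: ae.
  by apply: negligibleU; apply/negligibleP => //; exact: lebesgue_measure_set1.
(* The property propagated along the interval: the growth of [phi] is paid by the drift and by the
   variation over finitely many disjoint intervals whose length is charged to [G]. *)
pose Q s := exists l, [/\ disjoint_pairs a s l,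
   \sum_(p <- l) (p.2 - p.1) <= len_upto G a s &
   phi s <= phi a + e * (s - a) + \sum_(p <- l) `|phi p.2 - phi p.1| ].
(* Around each [c], [Q] passes from any point just left of [c] to any point just right of it. If [c]
   lies in [G], the interval from [p] to [q] is added to the list; otherwise the Dini bound at [c]
   is used on both sides. *)
have step c : a <= c <= b -> exists2 h, 0 < h & forall p q,
    c - h < p -> a <= p -> p <= c -> c <= q -> q < c + h -> q <= b -> Q p -> Q q.
  move=> /andP[ac' cb].
  have [Gc|Gc] := pselect (G c).
    have /nbhs_ballP[h /= h0 hG] : nbhs c G by exact: open_nbhs_nbhs.
    exists h => // p q cp ap pc cq qc qb [l [l1 l2 l3]].
    have pq : p <= q by exact: le_trans cq.
    exists ((p, q) :: l); split.
    - exact: disjoint_pairs_cons.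
    - rewrite big_cons/= addrC; apply: le_trans (len_upto_step oG ap pq _).
        by rewrite lerD2r.
      move=> z /andP[pz zq]; apply: hG; rewrite /ball/= ltr_norml; lra.
    - rewrite big_cons/=; have := ler_norm (phi q - phi p).
      have : e * (q - a) = e * (p - a) + e * (q - p) by ring.
      have : 0 <= e * (q - p) by rewrite mulr_ge0 ?subr_ge0// ltW.
      lra.
  have acb : a < c < b.
    rewrite !lt_neqAle ac' cb !andbT; apply/andP; split; apply/eqP => E; apply: Gc.
      by apply: NG; right; left.
    by apply: NG; right; right.
  have [/= cD|cD] := pselect ([set s | a < s < b -> forall e, 0 < e ->
     \forall s' \near s, (phi s' - phi s) * (s' - s) <= e * (s' - s) ^+ 2] c); last first.
    by exfalso; apply: Gc; apply: NG; left.
  have /nbhs_ballP[h /= h0 hP] := cD acb _ e_gt0.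
  exists h => // p q cp ap pc cq qc qb [l [l1 l2 l3]].
  have pq : p <= q by exact: le_trans cq.
  exists l; split.
  - exact: disjoint_pairsW l1.
  - by apply: (le_trans l2); exact: len_upto_mono.
  - have Hp : phi c - phi p <= e * (c - p).
      have [<-|pc'] := eqVneq p c; first by rewrite !subrr mulr0.
      have : 0 < c - p by rewrite subr_gt0 lt_neqAle pc' pc.
      have := hP p; rewrite /ball/= ltr_norml => /(_ ltac:(lra)) H cp0.
      rewrite -(ler_pM2r cp0); nra.
    have Hq : phi q - phi c <= e * (q - c).
      have [<-|qc'] := eqVneq c q; first by rewrite !subrr mulr0.
      have : 0 < q - c by rewrite subr_gt0 lt_neqAle qc' cq.
      have := hP q; rewrite /ball/= ltr_norml => /(_ ltac:(lra)) H cp0.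
      rewrite -(ler_pM2r cp0); nra.
    have : e * (q - a) = e * (p - a) + e * (q - c) + e * (c - p) by ring.
    lra.
have Qa : Q a.
  exists [::]; rewrite !big_nil !subrr mulr0 !addr0; split => //.
  by rewrite /len_upto fine_ge0// measure_ge0.
(* At the supremum [c] of the points satisfying [Q], crossing [c] either reaches [b] or gives a
   point of [S] beyond [c], which is absurd. *)
pose S := [set s | a <= s <= b /\ Q s].
have Sa : S a by split; rewrite ?lexx.
have Sb : has_sup S by split; [exists a | exists b => z -[/andP[]]].
pose c := sup S.
have ac' : a <= c by apply: ub_le_sup => //; case: Sb.
have cb : c <= b by apply: ge_sup; [exists a | move=> z [/andP[]]].
have [|h h0 H] := step c; first by rewrite ac'.
have [p Sp cp] := sup_adherent h0 Sb.
have pc : p <= c by apply: ub_le_sup => //; case: Sb.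
case: Sp => /andP[ap pb] Qp.
have Qb : Q b.
  have [bh|hb] := ltP b (c + h).
    exact: (H p b).
  have : S (c + h / 2).
    split; first lra.
    by apply: (H p) => //; lra.
  move=> /(ub_le_sup (proj2 Sb)); rewrite -/c; lra.
have [l [l1 l2 l3]] := Qb.
apply: (le_trans l3); rewrite lerD2l ltW// acd//.
apply: (le_lt_trans l2); rewrite -lte_fin fineK ?mu_upto_fin//.
apply: le_lt_trans Gd; apply: le_measure; rewrite ?inE.
- by apply: measurableI => //; exact: measurable_realfun.open_measurable.
- exact: measurable_realfun.open_measurable.
- exact: subIsetl.
Qed.

End Growth.

Lemma ae_lebesgueS {R : realType} (P Q : R -> Prop) : (forall s, P s -> Q s) ->
  {ae @lebesgue_measure R, forall s, P s} -> {ae @lebesgue_measure R, forall s, Q s}.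
Proof.
by move=> PQ; apply: filterS; first exact: (ae_filter_ringOfSetsType (@lebesgue_measure R)).
Qed.

(** * Absolutely continuous curves and a Gronwall comparison *)

Section AbsolutelyContinuousCurves.
Context {R : realType} {k : nat}.
Implicit Types (x : R -> 'cV[R]_k) (phi : R -> R).

Lemma abs_continuousW x a b a' b' : a <= a' -> b' <= b ->
  abs_continuous a b x -> abs_continuous a' b' x.
Proof.
move=> aa bb ac e e0; have [d d0 H] := ac e e0; exists d => // s s1; apply: H.
by apply: sub_all s1 => p /and3P[p1 -> p2]; rewrite (le_trans aa)//= (le_trans p2).
Qed.

Lemma abs_continuous_uniform x a b e : abs_continuous a b x -> 0 < e ->
  exists2 d, 0 < d & forall p q, a <= p -> p <= q -> q <= b -> q - p < d ->
    enorm (x q - x p) < e.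
Proof.
move=> ac e0; have [d d0 H] := ac e e0; exists d => // p q ap pq qb qpd.
by have := H [:: (p, q)]; rewrite /= !big_seq1 /= ap pq qb; apply.
Qed.

(** The interval is covered by finitely many hops of length [d / 2], on each of which the curve
    moves by less than 1. *)
Lemma abs_continuous_bounded x a b : abs_continuous a b x ->
  exists2 M, 0 <= M & forall s, a <= s <= b -> enorm (x s - x a) <= M.
Proof.
move=> ac; have [d d0 H] := abs_continuous_uniform ac ltr01.
have d2 : 0 < d / 2 by rewrite divr_gt0.
have P n : forall s, a <= s <= b -> s - a <= n%:R * (d / 2) ->
    enorm (x s - x a) <= n%:R.
  elim: n => [|n IH] s /andP[as_ sb]; rewrite ?mul0r => sn.
    have -> : s = a by apply: le_anti; rewrite as_ andbT; lra.
    by rewrite subrr enorm0.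
  have [sl|sl] := leP s (a + d / 2).
    apply: (@le_trans _ _ 1); last by rewrite ler1n.
    by apply/ltW/H => //; lra.
  apply: (le_trans (enorm_distD _ (x (s - d / 2)) _)).
  rewrite -[leRHS]natr1 [leRHS]addrC lerD//.
    by apply/ltW/H; lra.
  by apply: IH; [lra | move: sn; rewrite -(natr1 n); lra].
have [ab|ba] := leP a b; last by exists 0 => // s; lra.
exists (Num.truncn ((b - a) / (d / 2))).+1%:R => // s sab.
apply: P => //; rewrite -ler_pdivrMr//.
apply: (@le_trans _ _ ((b - a) / (d / 2))); last first.
  by rewrite ltW// truncnS_gt.
by rewrite ler_pM2r ?invr_gt0//; lra.
Qed.

(** [phi] inherits absolute continuity from [x] through the bound on its increments. This serves
    scalar functions of the state and of time. *)
Lemma abs_continuous_dini_le x phi a b C : a <= b -> abs_continuous a b x ->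
  (forall p q, a <= p -> p <= q -> q <= b ->
     `|phi q - phi p| <= C * (enorm (x q - x p) + (q - p))) ->
  {ae @lebesgue_measure R, forall s, a < s < b -> forall e, 0 < e ->
     \forall s' \near s, (phi s' - phi s) * (s' - s) <= e * (s' - s) ^+ 2} ->
  phi b <= phi a.
Proof.
move=> ab ac modphi; apply: abs_cont_dini_le => // e e0.
pose C1 : R := `|C| + 1.
have C10 : 0 < C1 by rewrite ltr_wpDl.
have e1 : 0 < e / C1 / 2 by rewrite !divr_gt0.
have [d d0 H] := ac _ e1.
(* Half of [e / C1] is left to the variation of [x] and half to the total length. *)
exists (Num.min d (e / C1 / 2)); first by rewrite lt_min d0.
move=> s [s1 s2]; rewrite lt_min => /andP[sd se].
apply: (@le_lt_trans _ _
   (C1 * (\sum_(p <- s) enorm (x p.2 - x p.1) + \sum_(p <- s) (p.2 - p.1)))).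
  rewrite -big_split mulr_sumr big_seq [leRHS]big_seq; apply: ler_sum => p ps.
  have /and3P[p1 p2 p3] := allP s1 _ ps.
  apply: le_trans (modphi _ _ p1 p2 p3) _.
  have := enorm_ge0 (x p.2 - x p.1); have := ler_norm C.
  by move=> CC n0; apply: ler_wpM2r; rewrite /C1; lra.
have sx := H s s1 s2 sd.
by rewrite -ltr_pdivlMl// mulrC; lra.
Qed.

(** The limit of difference quotients rewritten as a first-order expansion, which also holds at
    [s' = s]. *)
Lemma is_derive_near (V : normedModType R) (f : R -> V) s v (e : R) :
  is_derive s (1 : R) f v -> 0 < e ->
  \forall s' \near s, `|f s' - f s - (s' - s) *: v| <= e * `|s' - s|.
Proof.
move=> [df <-] e0.
have := df; rewrite /derivable => /cvg_ex[/= l fl].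
have -> : 'D_1 f s = l by apply/cvg_lim.
move/cvgrPdist_le: fl => /(_ _ e0); rewrite near_withinE.
move=> /nbhs_ballP[d /= d0 H]; apply/nbhs_ballP; exists d => // s' /= ss'.
have [->|ne] := eqVneq s' s; first by rewrite !subrr scale0r subr0 !normr0 mulr0.
have n0 : s' - s != 0 by rewrite subr_eq0.
have := H (s' - s); rewrite /ball/= sub0r normrN distrC => /(_ ss' n0).
rewrite [_%:A]mulr1 subrK => {}H.
rewrite -[X in X - _](scalerKV n0) -scalerBr normrZ (distrC s s') [leLHS]mulrC ler_wpM2r//.
by rewrite distrC.
Qed.

(** The gap [c - d] absorbs the first-order remainder. Multiplying by [s' - s] lets a single
    inequality cover both sides of [s]. *)
Lemma is_derive_dini phi s d c : is_derive s (1 : R) phi d -> d < c ->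
  \forall s' \near s, (phi s' - phi s) * (s' - s) <= c * (s' - s) ^+ 2.
Proof.
move=> df dc; have cd : 0 < c - d by rewrite subr_gt0.
have := is_derive_near df cd; apply: filterS => s' H.
set h := s' - s in H *; set D := phi s' - phi s in H *.
have : (D - h * d) * h <= `|D - h * d| * `|h| by rewrite -normrM ler_norm.
have : `|D - h * d| * `|h| <= (c - d) * `|h| * `|h| by rewrite ler_wpM2r.
have : `|h| * `|h| = h ^+ 2 by rewrite -normrM -expr2 ger0_norm ?sqr_ge0.
by rewrite -mulrA => ->; nra.
Qed.

Lemma is_derive_enorm_near x s v (e : R) : is_derive s (1 : R) x v -> 0 < e ->
  \forall s' \near s, enorm (x s' - x s) <= (enorm v + e) * `|s' - s|.
Proof.
move=> dx e0; have e1 : 0 < e / k.+1%:R by rewrite divr_gt0.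
have := is_derive_near dx e1; apply: filterS => s' H.
rewrite -[x s' - x s](subrK ((s' - s) *: v)) mulrDl [leRHS]addrC.
apply: ler_enormD; last by rewrite enormZ mulrC.
apply: (le_trans (enorm_le_norm _)).
by rewrite -ler_pdivlMl// mulrA [_^-1 * _]mulrC.
Qed.

(* With [m] the function obtained from [phi] by replacing the norm by its
   first-order upper bound at [s], [phi <= m] to the right of [s] and
   [m <= phi] to the left. *)
Lemma gronwall_curve x (x0 : 'cV[R]_k) (z dz : R -> R) (A C a b : R) : 0 <= A -> a <= b ->
  abs_continuous a b x ->
  (forall s, a < s < b -> is_derive s (1 : R) z (dz s)) ->
  (forall p q, a <= p -> p <= q -> q <= b -> `|z q - z p| <= C * (q - p)) ->
  {ae @lebesgue_measure R, forall s, a < s < b ->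
     exists2 v, is_derive s (1 : R) x v &
       enorm v - dz s <= A * (enorm (x s - x0) - z s)} ->
  enorm (x a - x0) <= z a -> enorm (x b - x0) <= z b.
Proof.
move=> A0 ab ac dz_ lipz ae xa.
(* Integrating factor: [E * psi] will be nonincreasing, and [psi a] is nonpositive by assumption. *)
pose E s : R := expR (- A * (s - a)).
pose psi s := enorm (x s - x0) - z s.
have Egt0 s : 0 < E s by exact: expR_gt0.
have Ele1 s : a <= s -> E s <= 1.
  by move=> as_; rewrite -expR0 ler_expR mulNr oppr_le0 mulr_ge0// subr_ge0.
suff : E b * psi b <= E a * psi a.
  rewrite /E subrr mulr0 expR0 mul1r -/(E b) => H.
  have : E b * psi b <= 0 by apply: (le_trans H); rewrite subr_le0.
  by rewrite pmulr_rle0// subr_le0.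
have [M M0 HM] := abs_continuous_bounded ac.
pose C1 : R := `|C|; have C10 : 0 <= C1 by exact: normr_ge0.
have lipz1 p q : a <= p -> p <= q -> q <= b -> `|z q - z p| <= C1 * (q - p).
  move=> ap pq qb; apply: (le_trans (lipz _ _ ap pq qb)).
  by rewrite ler_wpM2r ?subr_ge0// ler_norm.
pose P := M + enorm (x a - x0) + (C1 * (b - a) + `|z a|).
have psiP s : a <= s <= b -> `|psi s| <= P.
  move=> /[dup] sab /andP[as_ sb]; apply: (le_trans (ler_normB _ _)); rewrite lerD//.
    rewrite ger0_norm ?enorm_ge0//.
    by apply: (le_trans (enorm_distD _ (x a) _)); rewrite lerD// HM.
  rewrite -[z s](subrK (z a)) (le_trans (ler_normD _ _))// lerD//.
  apply: (le_trans (lipz1 _ _ _ as_ sb)) => //.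
  by rewrite ler_wpM2l//; lra.
have P0 : 0 <= P by rewrite /P !addr_ge0 ?enorm_ge0// mulr_ge0// subr_ge0.
(* In the constant, 1 accounts for the norm, [C1] for [z], and [A * P] for [E], which is
   [A]-Lipschitz and multiplies a function bounded by [P]. *)
apply: (@abs_continuous_dini_le x (fun s => E s * psi s) a b (1 + C1 + A * P)) => //.
  move=> p q ap pq qb.
  have -> : E q * psi q - E p * psi p = E q * (psi q - psi p) + (E q - E p) * psi p.
    by ring.
  set n := enorm (x q - x p); have n0 : 0 <= n by exact: enorm_ge0.
  have pq0 : 0 <= q - p by rewrite subr_ge0.
  have psi_pq : `|psi q - psi p| <= n + C1 * (q - p).
    rewrite /psi opprD addrACA (le_trans (ler_normD _ _))// lerD//.
      apply: (le_trans (ler_enorm_dist _ _)).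
      by rewrite opprB addrA subrK.
    by rewrite -opprD normrN lipz1.
  have E_pq : `|E q - E p| <= A * (q - p).
    have -> : E q = E p * expR (- A * (q - p)).
      by rewrite /E -expRD; congr expR; ring.
    rewrite -[X in _ - X]mulr1 -mulrBr normrM gtr0_norm//.
    rewrite (@le_trans _ _ (1 * `|expR (- A * (q - p)) - 1|))//.
      by rewrite ler_wpM2r// Ele1.
    rewrite mul1r ler0_norm; last first.
      by rewrite subr_le0 -expR0 ler_expR mulNr oppr_le0 mulr_ge0.
    by have := expR_ge1Dx (- A * (q - p)); lra.
  apply: (le_trans (ler_normD _ _)); rewrite !normrM (gtr0_norm (Egt0 _)).
  have H1 : E q * `|psi q - psi p| <= n + C1 * (q - p).
    apply: (@le_trans _ _ (1 * `|psi q - psi p|)); last by rewrite mul1r.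
    by rewrite ler_wpM2r// Ele1// (le_trans ap).
  have H2 : `|E q - E p| * `|psi p| <= A * (q - p) * P.
    by rewrite ler_pM// psiP// ap (le_trans pq).
  have : 0 <= C1 * n by rewrite mulr_ge0.
  have : 0 <= A * P * n by rewrite !mulr_ge0.
  lra.
apply: ae_lebesgueS ae => s + sab e e0 => /(_ sab)[v dx Hv].
have as_ : a <= s by case/andP: sab => /ltW.
have e2 : 0 < e / 2 by rewrite divr_gt0.
pose m t := E t * (enorm (x s - x0) + (enorm v + e / 2) * (t - s) - z t).
have dm : is_derive s (1 : R) m
    (E s * (- A * psi s + (enorm v + e / 2 - dz s))).
  have dzs := dz_ _ sab.
  have dE : is_derive s (1 : R) E (- A * E s).
    rewrite /E; apply: is_derive_eq.
    by rewrite /GRing.scale/=; ring.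
  rewrite /m; apply: is_derive_eq.
  rewrite /GRing.scale/= /psi; ring.
(* The differential inequality cancels [A * psi s], leaving at most [E s * (e / 2)], and
   [E s <= 1]. *)
have dle : E s * (- A * psi s + (enorm v + e / 2 - dz s)) < e.
  apply: (@le_lt_trans _ _ (1 * (e / 2))); last by lra.
  apply: (@le_trans _ _ (E s * (e / 2))).
    by rewrite ler_pM2l//; move: Hv; rewrite -/(psi s); lra.
  by apply: ler_wpM2r; [exact: ltW | exact: Ele1].
have := is_derive_dini dm dle; have := is_derive_enorm_near dx e2.
apply: filterS2 => t xt; apply: le_trans.
have H : `|psi t + z t - (psi s + z s)| <= (enorm v + e / 2) * `|t - s|.
  rewrite /psi !subrK (le_trans (ler_enorm_dist _ _))//.
  by rewrite opprB addrA subrK.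
have -> : m s = E s * psi s by rewrite /m subrr mulr0 addr0.
have [ts|ts] := leP s t.
  apply: ler_wpM2r; first by rewrite subr_ge0.
  rewrite lerD2r; apply: ler_wpM2l; first exact: ltW.
  by move: H; rewrite (@ger0_norm _ (t - s)) ?subr_ge0// ler_norml /psi; lra.
apply: ler_wnM2r; first by rewrite subr_le0 ltW.
rewrite lerD2r; apply: ler_wpM2l; first exact: ltW.
by move: H; rewrite (@ler0_norm _ (t - s)) ?subr_le0 ?(ltW ts)// ler_norml /psi; lra.
Qed.

End AbsolutelyContinuousCurves.

(** * Entrywise differentiability of matrix-valued functions *)

Section MatrixDifferentiability.
Context {R : realType} {V : normedModType R}.

(** Working entry by entry reduces matrix products to sums and products of scalar functions. *)
Definition entries_differentiable p q (F : V -> 'M[R]_(p, q)) (x : V) :=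
  forall i j, differentiable (fun y => F y i j) x.

Lemma entries_differentiable_cst p q (A : 'M[R]_(p, q)) x :
  entries_differentiable (fun=> A) x.
Proof. by move=> i j; exact: differentiable_cst. Qed.

Lemma entries_differentiableB p q (F G : V -> 'M[R]_(p, q)) x :
  entries_differentiable F x -> entries_differentiable G x ->
  entries_differentiable (fun y => F y - G y) x.
Proof.
move=> dF dG i j; rewrite (_ : (fun y => _) = (fun y => F y i j) - (fun y => G y i j)).
  exact: differentiableB.
by apply/funext => y; rewrite !mxE.
Qed.

Lemma entries_differentiable_tr p q (F : V -> 'M[R]_(p, q)) x :
  entries_differentiable F x -> entries_differentiable (fun y => (F y)^T) x.
Proof.
move=> dF i j; rewrite (_ : (fun y => _) = (fun y => F y j i)); first exact: dF.
by apply/funext => y; rewrite mxE.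
Qed.

Lemma entries_differentiable_mul p q r (F : V -> 'M[R]_(p, q))
    (G : V -> 'M[R]_(q, r)) x :
  entries_differentiable F x -> entries_differentiable G x ->
  entries_differentiable (fun y => F y *m G y) x.
Proof.
move=> dF dG i j.
rewrite (_ : (fun y => _) =
    \sum_(l < q) ((fun y => F y i l) * (fun y => G y l j) : V -> R)).
  by apply: differentiable_sum => l; exact: differentiableM.
by apply/funext => y; rewrite mxE fct_sumE.
Qed.

Lemma entries_differentiable_map p q (h : R -> R) (F : V -> 'M[R]_(p, q)) x :
  (forall r, differentiable h r) ->
  entries_differentiable F x -> entries_differentiable (fun y => map_mx h (F y)) x.
Proof.
move=> dh dF i j; rewrite (_ : (fun y => _) = h \o (fun y => F y i j)).
  by apply: differentiable_comp => //; exact: dF.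
by apply/funext => y; rewrite /= mxE.
Qed.

End MatrixDifferentiability.

(** * Gradients: chain rule, mean value bound, local minima *)

Section Gradient.
Context {R : realType} {k : nat}.
Implicit Types (W : 'cV[R]_k -> R) (v y : 'cV[R]_k).

(** [grad] collects derivatives along the basis vectors only; linearity of the differential extends
    this to every direction [v]. *)
Lemma diff_grad W y v : differentiable W y ->
  'd W y v = ((grad W y)^T *m v) 0 0.
Proof.
move=> dW; rewrite dotmxE {1}(matrix_sum_delta v) linear_sum /=.
apply: eq_bigr => i _; rewrite big_ord1 linearZ /= mxE mulrC.
by rewrite [LHS]mulrC deriveE// mulrC.
Qed.

Lemma is_derive_comp_grad W (x : R -> 'cV[R]_k) s v :
  is_derive s (1 : R) x v -> differentiable W (x s) ->
  is_derive s (1 : R) (W \o x) (((grad W (x s))^T *m v) 0 0).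
Proof.
move=> [dx dv] dW.
have dx' : differentiable x s by apply/derivable1_diffP.
have dWx : differentiable (W \o x) s by exact: differentiable_comp.
split; first exact/derivable1_diffP.
have E : 'd x s (1 : R) = v by rewrite -dv deriveE.
by rewrite deriveE// diff_comp//= E diff_grad.
Qed.

Lemma is_derive_segment (u v : 'cV[R]_k) (r : R) :
  is_derive r (1 : R) (fun r : R => u + r *: v) v.
Proof.
have dv : is_derive r (1 : R) (fun r : R => r *: v) v.
  have d : differentiable (fun r : R => r *: v) r by exact: differentiableZl.
  split; first exact/derivable1_diffP.
  by rewrite deriveE// diffZl//= diff_val scale1r.
have : is_derive r (1 : R) (cst u + (fun r : R => r *: v)) (0 + v).
  exact: is_deriveD.
by rewrite add0r.
Qed.

(** Mean value theorem along the segment from [u] to [v], followed by Cauchy-Schwarz. *)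
Lemma grad_bound_lipschitz W u v (c : R) : (forall y, differentiable W y) ->
  (forall r, 0 <= r <= 1 -> enorm (grad W (u + r *: (v - u))) <= c) ->
  `|W v - W u| <= c * enorm (v - u).
Proof.
move=> dW gW.
pose p (r : R) := u + r *: (v - u).
pose dp r := ((grad W (p r))^T *m (v - u)) 0 0.
have dWp r : is_derive r (1 : R) (W \o p) (dp r).
  by apply: is_derive_comp_grad => //; exact: is_derive_segment.
have [|r rI] := @MVT_segment R (W \o p) dp 0 1 ler01.
  by apply: derivable_within_continuous => r _; have [] := dWp r.
rewrite /= /p scale1r scale0r addr0 subr0 mulr1 [u + _]addrC subrK => ->.
have cG : enorm (grad W (p r)) <= c.
  by apply: gW; move: rI; rewrite in_itv.
rewrite ler_norml; apply/andP; split; last first.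
  by apply: (le_trans (enorm_dot _ _)); rewrite ler_wpM2r ?enorm_ge0.
(* The lower bound is the same estimate in the opposite direction. *)
have dpN : - dp r = ((grad W (p r))^T *m - (v - u)) 0 0 by rewrite mulmxN [RHS]mxE.
rewrite lerNl dpN; apply: (le_trans (enorm_dot _ _)).
by rewrite enormN ler_wpM2r ?enorm_ge0.
Qed.

(** The one-variable criterion for an interior minimum, applied along each coordinate axis through
    [y]. *)
Lemma grad_local_min W y (h : R) : 0 < h -> differentiable W y ->
  (forall z, enorm (z - y) < h -> differentiable W z /\ W y <= W z) -> grad W y = 0.
Proof.
move=> h0 dW minW; apply/matrixP => i j; rewrite ord1 !mxE.
pose p (r : R) := y + r *: (delta_mx i 0 : 'cV[R]_k).
have en1 : enorm (delta_mx i 0 : 'cV[R]_k) = 1.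
  rewrite /enorm (bigD1 i)//= big1 ?addr0 => [|l li]; last first.
    by rewrite mxE (negbTE li) expr0n.
  by rewrite mxE !eqxx expr1n sqrtr1.
have pin r : r \in `]-h, h[ -> enorm (p r - y) < h.
  by rewrite in_itv/= /p addrAC subrr add0r enormZ en1 mulr1 ltr_norml.
have p0 : p 0 = y by rewrite /p scale0r addr0.
have dWp r : differentiable W (p r) ->
    is_derive r (1 : R) (W \o p) (((grad W (p r))^T *m (delta_mx i 0 : 'cV[R]_k)) 0 0).
  by move=> d; apply: is_derive_comp_grad; [exact: is_derive_segment | exact: d].
have [||||_ d0] := @derive1_at_min R (W \o p) (-h) h 0.
- by lra.
- by move=> r /pin /minW[/dWp[]].
- by rewrite in_itv/= h0 oppr_lt0 h0.
- by move=> r /pin /minW[_]; rewrite /= p0.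
have := dWp 0; rewrite p0 => /(_ dW) [_]; rewrite d0 -diff_grad// -deriveE//.
Qed.

End Gradient.

(** * Smoothness of the Lyapunov function and a ball inside the angle domain *)

Section Model.
Context {R : realType} {n m : nat} (S : bidding_network R n m).

(** Stated for a general [F] so that it can be iterated down the nested blocks of the state. *)
Lemma entries_differentiable_block p q (F : 'cV[R]_(sdim n) -> 'cV[R]_(p + q)) x :
  entries_differentiable F x ->
  entries_differentiable (fun y => usubmx (F y)) x /\
  entries_differentiable (fun y => dsubmx (F y)) x.
Proof.
move=> dF; split=> i j.
  rewrite (_ : (fun y => _) = (fun y => F y (lshift _ i) j)); first exact: dF.
  by apply/funext => y; rewrite mxE.
rewrite (_ : (fun y => _) = (fun y => F y (rshift _ i) j)); first exact: dF.
by apply/funext => y; rewrite mxE.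
Qed.

Lemma qform_differentiable p (A : 'M[R]_p) (F : 'cV[R]_(sdim n) -> 'cV[R]_p) x :
  entries_differentiable F x -> differentiable (fun y => qform A (F y)) x.
Proof.
move=> dF; rewrite /qform; apply: entries_differentiable_mul => //.
apply: entries_differentiable_mul; last exact: entries_differentiable_cst.
exact: entries_differentiable_tr.
Qed.

Lemma potential_differentiable x :
  differentiable (fun y : 'cV[R]_(sdim n) => potential S (st_phi y)) x.
Proof.
have id_d : entries_differentiable (@id 'cV[R]_(sdim n)) x.
  by move=> i j; exact: differentiable_coord.
have [dphi _] := entries_differentiable_block id_d.
rewrite /potential; apply: (@differentiableN R); apply: entries_differentiable_mul.
  exact: entries_differentiable_cst.
apply: entries_differentiable_map.
  by move=> r; apply/derivable1_diffP; exact: derivable_cos.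
by apply: entries_differentiable_mul; first exact: entries_differentiable_cst.
Qed.

(** Apart from the potential, a combination of cosines of linear forms, the function is polynomial
    in the blocks of the state. *)
Lemma Wfun_differentiable e0 e1 e2 e3 xbar x :
  differentiable (Wfun S e0 e1 e2 e3 xbar) x.
Proof.
have dD (f g : 'cV[R]_(sdim n) -> R) : differentiable f x -> differentiable g x ->
    differentiable (fun y => f y + g y) x by exact: differentiableD.
have dB (f g : 'cV[R]_(sdim n) -> R) : differentiable f x -> differentiable g x ->
    differentiable (fun y => f y - g y) x by exact: differentiableB.
have dM (f g : 'cV[R]_(sdim n) -> R) : differentiable f x -> differentiable g x ->
    differentiable (fun y => f y * g y) x by exact: differentiableM.
have dc (c : R) : differentiable (fun=> c : R) x by exact: differentiable_cst.
have cst p q (A : 'M[R]_(p, q)) := @entries_differentiable_cst R _ p q A x.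
have id_d : entries_differentiable (@id 'cV[R]_(sdim n)) x.
  by move=> i j; exact: differentiable_coord.
have [dphi /entries_differentiable_block[domega]] := entries_differentiable_block id_d.
move=> /entries_differentiable_block[db].
move=> /entries_differentiable_block[dPg dlam].
have dlambda : differentiable (fun y => st_lambda y - st_lambda xbar) x.
  by apply: dB => //; exact: dlam.
have tmul p q (F G : _ -> 'cV[R]__) (A : 'M[R]_(p, q)) :
    entries_differentiable F x -> entries_differentiable G x ->
    differentiable (fun y => ((F y)^T *m A *m G y) 0 0) x.
  move=> dF dG; apply: entries_differentiable_mul => //.
  by apply: entries_differentiable_mul => //; exact: entries_differentiable_tr.
have dpot := potential_differentiable x.
have sub p (F : _ -> 'cV[R]_p) c : entries_differentiable F x ->
  entries_differentiable (fun y => F y - c) x.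
  by move=> dF; apply: entries_differentiableB.
rewrite /Wfun /Vfun; apply: (dB); [apply: (dB); [apply: (dD)|]|].
- apply: (dD); last apply: (dM) => //.
    apply: (dD); last by apply: (dM) => //; exact: qform_differentiable.
    apply: (dB) => //; apply: (dB) => //.
    apply: entries_differentiable_mul => //.
    by apply: entries_differentiable_tr; exact: sub.
  apply: (dD); first by apply: (dD); apply: qform_differentiable; exact: sub.
  by apply: (dM) => //; rewrite (_ : (fun y => _) =
    (fun y => (st_lambda y - st_lambda xbar) * (st_lambda y - st_lambda xbar))) //;
    exact: dM.
- apply: (dM) => //.
  (* Reassociation groups the two constant matrices into one, as [tmul] expects. *)
  rewrite (_ : (fun y => _) = (fun y => ((st_phi y - st_phi xbar)^T
      *m (Dtdag S *m inertia S) *m st_omega y) 0 0)).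
    by apply: tmul => //; exact: sub.
  by apply/funext => y; rewrite !mulmxA.
- by apply: (dM) => //; apply: tmul; exact: sub.
- apply: (dM); first exact: dM.
  by apply: entries_differentiable_mul => //; exact: sub.
Qed.

(** Edge angles depend linearly on the state, so the strict slack [gamma - M] tolerates a small
    displacement. *)
Lemma angle_domain_ball xbar (gamma : R) :
  mx_norm (edge_angle S (st_phi xbar)) < gamma ->
  exists2 r, 0 < r & forall x, enorm (x - xbar) <= r -> angle_domain S gamma x.
Proof.
set M := mx_norm _ => Mg; rewrite /angle_domain.
pose A := (Dmx S)^T *m (Dtdag S)^T.
pose C : R := \sum_i \sum_j `|A i j|.
have C0 : 0 <= C by apply: sumr_ge0 => i _; apply: sumr_ge0.
(* [C] bounds every row sum of absolute values; adding 1 keeps the denominator positive even if [C]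
   is 0. *)
exists ((gamma - M) / (C + 1)); first by rewrite divr_gt0 ?subr_gt0// ltr_wpDl.
move=> x xr l /=; rewrite -ler_norml.
have -> : edge_angle S (st_phi x) l 0 = edge_angle S (st_phi xbar) l 0 +
    \sum_j A l j * (x - xbar) (lshift _ j) 0.
  rewrite /edge_angle -/A 2!mxE -big_split; apply: eq_bigr => j _.
  by rewrite /= -mulrDr; congr (_ * _); rewrite !mxE [RHS]addrC subrK.
have -> : gamma = M + (gamma - M) by rewrite addrC subrK.
rewrite (le_trans (ler_normD _ _))// lerD//.
  rewrite /M mx_normrE; apply/bigmax_geP; right; exists (l, 0) => //.
apply: (@le_trans _ _ (C * enorm (x - xbar))).
  apply: (le_trans (ler_norm_sum _ _ _)).
  apply: (@le_trans _ _ (\sum_j `|A l j| * enorm (x - xbar))).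
    apply: ler_sum => j _; rewrite normrM ler_wpM2l//; exact: ler_coord_enorm.
  rewrite -mulr_suml ler_wpM2r ?enorm_ge0// /C (bigD1 l)//= lerDl.
  by apply: sumr_ge0 => i _; apply: sumr_ge0.
apply: (@le_trans _ _ ((C + 1) * enorm (x - xbar))).
  by rewrite ler_wpM2r ?enorm_ge0// lerDl.
by rewrite -ler_pdivlMl ?ltr_wpDl// mulrC.
Qed.

End Model.

(** * The scalar comparison function of the Gronwall estimates *)

Section ExponentialGrowth.
Context {R : realType}.
Implicit Types (a r s K : R).

(* Solution at time [r] of [z' = a z + 1], [z 0 = 0]. *)
Definition expgrow a r : R := (expR (a * r) - 1) / a.

Lemma expgrow0 a : expgrow a 0 = 0.
Proof. by rewrite /expgrow mulr0 expR0 subrr mul0r. Qed.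

Lemma expgrowE a r : 0 < a -> expR (a * r) = a * expgrow a r + 1.
Proof. by move=> a0; rewrite /expgrow mulrCA mulfV ?gt_eqF// mulr1 subrK. Qed.

Lemma expgrow_mono a : 0 < a -> {homo expgrow a : r s / r <= s}.
Proof.
move=> a0 r s rs; rewrite /expgrow ler_pM2r ?invr_gt0// lerD2r ler_expR.
by rewrite ler_pM2l.
Qed.

Lemma is_derive_expgrow a K t0 s : 0 < a ->
  is_derive s (1 : R) (fun s => K * expgrow a (s - t0)) (K * expR (a * (s - t0))).
Proof.
move=> a0; rewrite /expgrow.
have dE : is_derive s (1 : R) (fun s => expR (a * (s - t0)))
    (a * expR (a * (s - t0))).
  apply: is_derive_eq; rewrite /GRing.scale/=; ring.
apply: is_derive_eq; rewrite /GRing.scale/=; field.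
by rewrite gt_eqF.
Qed.

(** Convexity of the exponential, in the form [1 + x <= expR x], bounds the slope by its value at
    the right end [b]. *)
Lemma expgrow_lipschitz a K t0 b p q : 0 < a -> 0 <= K -> p <= q -> q <= b ->
  `|K * expgrow a (q - t0) - K * expgrow a (p - t0)| <=
  K * expR (a * (b - t0)) * (q - p).
Proof.
move=> a0 K0 pq qb; rewrite -mulrBr normrM (ger0_norm K0) -mulrA ler_wpM2l//.
rewrite ger0_norm ?subr_ge0 ?expgrow_mono ?lerD2r//.
rewrite -(ler_pM2l a0) mulrBr.
rewrite [leLHS](_ : _ = expR (a * (q - t0)) - expR (a * (p - t0))); last first.
  by rewrite !expgrowE//; ring.
have -> : expR (a * (p - t0)) = expR (a * (q - t0)) * expR (- (a * (q - p))).
  by rewrite -expRD; congr expR; ring.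
have H := expR_ge1Dx (- (a * (q - p))).
have E0 := expR_gt0 (a * (q - t0)).
have EE : expR (a * (q - t0)) <= expR (a * (b - t0)).
  by rewrite ler_expR ler_pM2l// lerD2r.
have aq : 0 <= a * (q - p) by rewrite mulr_ge0 ?subr_ge0// ltW.
nra.
Qed.

(** Inverts the logarithm: [xi_bar] and [zeta_bar] both have the form [a^-1 * ln (1 + c)]. *)
Lemma expgrow_le_ln a r c : 0 < a -> 0 < 1 + c -> r <= a^-1 * ln (1 + c) ->
  expgrow a r <= c / a.
Proof.
move=> a0 c0 rl; rewrite /expgrow ler_pM2r ?invr_gt0// lerBlDl.
rewrite -[leRHS](@lnK _ (1 + c)) ?posrE// ler_expR.
by rewrite -ler_pdivlMl.
Qed.

End ExponentialGrowth.

(** * The sampling grid covers the half-line *)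

Section TimeGrid.
Context {R : realType} (N : nat -> nat) (t : nat -> nat -> R).
Hypothesis t_seq : time_sequence N t.

Lemma time_grid_step l i : (i < N l)%N -> t l i < t l i.+1.
Proof. by have [_ _ H _] := t_seq => iN; exact: (H l i.+1). Qed.

Lemma time_grid_mono l i j : (i <= j)%N -> (j <= N l)%N -> t l i <= t l j.
Proof.
elim: j => [|j IH]; first by rewrite leqn0 => /eqP ->.
rewrite leq_eqVlt => /orP[/eqP ->//|ij] jN.
by rewrite (le_trans (IH _ (ltnW jN)))// ltW// time_grid_step.
Qed.

Lemma time_grid_ge0 l : 0 <= t l 0%N.
Proof.
have [_ t0 _ tN] := t_seq; elim: l => [|l IH]; first by rewrite t0.
by rewrite tN (le_trans IH)// time_grid_mono.
Qed.

(** Block starts grow at least linearly, so one of them exceeds [s]. The first such start identifies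
    the block before it as the one containing [s], and the first later instant in that block
    identifies the step. *)
Lemma time_grid_cover xi : 0 < xi ->
  (forall l, xi <= t l.+1 0%N - t l 0%N) -> forall s, 0 <= s ->
  exists l i, (i < N l)%N /\ t l i <= s < t l i.+1.
Proof.
move=> xi0 xil s s0; have [N1 t0 _ tN] := t_seq.
have lin l : l%:R * xi <= t l 0%N.
  elim: l => [|l IH]; first by rewrite mul0r t0.
  by rewrite -natr1 mulrDl mul1r; have := xil l; lra.
have exl : exists l, s < t l 0%N.
  exists (Num.truncn (s / xi)).+1; apply: (lt_le_trans _ (lin _)).
  by rewrite -ltr_pdivrMr// truncnS_gt.
case: (ex_minnP exl) => -[|l]; first by rewrite t0 ltNge s0.
move=> sl minl.
have ls : t l 0%N <= s by rewrite leNgt; apply/negP => /minl; rewrite ltnn.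
have exi : exists i, (i <= N l)%N && (s < t l i) by exists (N l); rewrite leqnn -tN.
case: (ex_minnP exi) => -[|i]; first by rewrite ltNge ls andbF.
move=> /andP[iN si] mini; exists l, i; split=> //; rewrite si andbT leNgt.
by apply/negP => sti; have := mini i; rewrite sti (ltnW iN) ltnn => /(_ isT).
Qed.

End TimeGrid.

(** * Stability of a sampled system from a Lyapunov function on a ball *)

Section SampledLyapunov.
Context {R : realType} {k : nat}.
Context (f g h : 'cV[R]_k -> 'cV[R]_k) (xbar : 'cV[R]_k) (W : 'cV[R]_k -> R).
Context (Lf Lg Lh LW alpha beta : R).
Hypothesis xbar_eq : f xbar + g xbar + h xbar = 0.
Hypotheses (Lf_gt0 : 0 < Lf) (Lg_gt0 : 0 < Lg) (Lh_gt0 : 0 < Lh) (LW_gt0 : 0 < LW).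
Hypotheses (Lf_lip : lipschitz_const Lf f) (Lg_lip : lipschitz_const Lg g)
  (Lh_lip : lipschitz_const Lh h) (LW_lip : lipschitz_const LW (grad W)).
Hypotheses (beta_gt0 : 0 < beta) (beta_lt : beta < alpha).
Context (N : nat -> nat) (t : nat -> nat -> R).
Hypothesis t_seq : time_sequence N t.
Hypothesis block_len : forall l, t l.+1 0%N - t l 0%N <= xi_bar Lf Lg Lh LW beta.
Hypothesis step_len : forall l i, (i < N l)%N ->
  t l i.+1 - t l i <= zeta_bar Lf Lg Lh LW alpha beta.

Context (xi rad c1 c2 : R).
Hypotheses (xi_gt0 : 0 < xi) (block_len_ge : forall l, xi <= t l.+1 0%N - t l 0%N).
Hypotheses (rad_gt0 : 0 < rad) (c1_gt0 : 0 < c1) (c2_gt0 : 0 < c2).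
Hypothesis W_diff : forall z, differentiable W z.
Hypothesis W_ball : forall z, enorm (z - xbar) <= rad ->
  [/\ 2^-1 * c1 * enorm (z - xbar) ^+ 2 <= W z,
      W z <= 2^-1 * c2 * enorm (z - xbar) ^+ 2
    & ((grad W z)^T *m (f z + g z + h z)) 0 0 <= - alpha * enorm (z - xbar) ^+ 2].

Let a := Lf + Lg.
Let L := Lf + Lg + Lh.
Let a_gt0 : 0 < a. Proof. by rewrite addr_gt0. Qed.
Let L_gt0 : 0 < L. Proof. by rewrite !addr_gt0. Qed.

Let hxbar : h xbar = - (f xbar + g xbar).
Proof. by apply/eqP; rewrite -addr_eq0 addrC xbar_eq. Qed.

Section Solution.
Context (x : R -> 'cV[R]_k).
Hypothesis x_sol : tt_solution f g h N t x.

Let y s := enorm (x s - xbar).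
Let y_ge0 s : 0 <= y s. Proof. exact: enorm_ge0. Qed.

Let x_ac p q : 0 <= p -> abs_continuous p q x.
Proof.
move=> p0; have [acx _] := x_sol.
have [q0|q0] := ltP 0 q; first exact: (abs_continuousW p0 (lexx q) (acx _ q0)).
(* Solutions are given on [[0, T]] with [T] positive; when [q <= 0] any positive horizon serves,
   here 1. *)
apply: (@abs_continuousW _ _ _ 0 1) => //; first by rewrite (le_trans q0).
exact: acx.
Qed.

Let x_derive l i p q : (i < N l)%N -> t l i <= p -> q <= t l i.+1 ->
  {ae @lebesgue_measure R, forall s, p < s < q ->
   is_derive s (1 : R) x (f (x s) + g (x (t l i)) + h (x (t l 0%N)))}.
Proof.
move=> iN tp qt; have [_] := x_sol.
apply: ae_lebesgueS => s H /andP[ps sq]; apply: H => //.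
  apply: (le_trans (time_grid_ge0 t_seq l)); apply: (@le_trans _ _ (t l i)).
    by apply: (time_grid_mono t_seq) => //; exact: ltnW.
  by rewrite (le_trans tp)// ltW.
by rewrite (le_trans tp (ltW ps)) (lt_le_trans sq).
Qed.

Let t_ge0 l i : (i <= N l)%N -> 0 <= t l i.
Proof.
move=> iN; apply: (le_trans (time_grid_ge0 t_seq l)).
exact: (time_grid_mono t_seq).
Qed.

(** Induction over the steps of the block, comparing with [z' = a * z + K]. The argument of [g] is
    frozen at [t l i], where the deviation is at most [z (t l i)] by induction, hence at most the
    current [z]; this is why the rate is [Lf + Lg]. *)
Lemma block_deviation_growth l i s : (i <= N l)%N -> t l 0%N <= s <= t l i ->
  enorm (x s - x (t l 0%N)) <= L * y (t l 0%N) * expgrow a (s - t l 0%N).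
Proof.
set t0 := t l 0%N; set K := L * y t0.
have K0 : 0 <= K by rewrite mulr_ge0 ?y_ge0// ltW.
elim: i s => [|i IH] s iN /andP[ts st].
  have -> : s = t0 by apply: le_anti; rewrite st ts.
  by rewrite !subrr enorm0 expgrow0 mulr0.
have [si|/ltW si] := leP s (t l i); first by apply: IH; rewrite ?ts// ltnW.
have IHi : enorm (x (t l i) - x t0) <= K * expgrow a (t l i - t0).
  by apply: IH; [exact: ltnW | rewrite lexx andbT (time_grid_mono t_seq)// ltnW].
pose z s := K * expgrow a (s - t0).
pose dz s := K * expR (a * (s - t0)).
apply: (@gronwall_curve _ _ x (x t0) z dz Lf (K * expR (a * (s - t0))) (t l i) s) => //.
- exact: ltW.
- by apply: x_ac; apply: t_ge0; exact: ltnW.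
- by move=> r _; exact: is_derive_expgrow.
- by move=> p q _ pq qs; exact: expgrow_lipschitz.
apply: ae_lebesgueS (x_derive iN (lexx _) st) => r H rs.
eexists; first exact: H.
rewrite -/t0; set v := (X in enorm X).
have ir : t l i <= r by case/andP: rs => /ltW.
(* The equilibrium equation allows the values at [xbar] to be subtracted, so that only Lipschitz
   differences remain. *)
have -> : v = (f (x r) - f (x t0)) + (g (x (t l i)) - g (x t0)) +
   ((f (x t0) - f xbar) + (g (x t0) - g xbar) + (h (x t0) - h xbar)).
  by rewrite hxbar; apply/matrixP => ? ?; rewrite !mxE; ring.
have : enorm ((f (x r) - f (x t0)) + (g (x (t l i)) - g (x t0)) +
   ((f (x t0) - f xbar) + (g (x t0) - g xbar) + (h (x t0) - h xbar))) <=
   Lf * enorm (x r - x t0) + Lg * enorm (x (t l i) - x t0) + (Lf * y t0 + Lg * y t0 + Lh * y t0).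
  by do ! (apply: ler_enormD; rewrite ?Lf_lip ?Lg_lip ?Lh_lip//).
have zr : z (t l i) <= z r.
  by rewrite /z ler_wpM2l// expgrow_mono// lerD2r.
have dzr : dz r = a * z r + K.
  by rewrite /dz expgrowE// /z; ring.
have := ler_wpM2l (ltW Lg_gt0) (le_trans IHi zr).
rewrite dzr /K /L /a; lra.
Qed.

(** Within a step only the argument of [f] moves, so the rate is [Lf]. The two frozen states are
    kept apart, to be compared with the current state separately. *)
Lemma step_deviation_growth l i s : (i < N l)%N -> t l i <= s <= t l i.+1 ->
  enorm (x s - x (t l i)) <=
  (a * y (t l i) + Lh * y (t l 0%N)) * expgrow Lf (s - t l i).
Proof.
set t0 := t l 0%N; set ti := t l i; set K := a * y ti + Lh * y t0.
have K0 : 0 <= K by rewrite addr_ge0// mulr_ge0 ?y_ge0// ltW.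
move=> iN /andP[ts st].
pose z s := K * expgrow Lf (s - ti).
pose dz s := K * expR (Lf * (s - ti)).
apply: (@gronwall_curve _ _ x (x ti) z dz Lf (K * expR (Lf * (s - ti))) ti s) => //.
- exact: ltW.
- by apply: x_ac; apply: t_ge0; exact: ltnW.
- by move=> r _; exact: is_derive_expgrow.
- by move=> p q _ pq qs; exact: expgrow_lipschitz.
- apply: ae_lebesgueS (x_derive iN (lexx _) st) => r H rs.
  eexists; first exact: H.
  rewrite -/t0 -/ti; set v := (X in enorm X).
  have -> : v = (f (x r) - f (x ti)) +
     ((f (x ti) - f xbar) + (g (x ti) - g xbar) + (h (x t0) - h xbar)).
    by rewrite hxbar; apply/matrixP => ? ?; rewrite !mxE; ring.
  have : enorm ((f (x r) - f (x ti)) +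
     ((f (x ti) - f xbar) + (g (x ti) - g xbar) + (h (x t0) - h xbar))) <=
     Lf * enorm (x r - x ti) + (Lf * y ti + Lg * y ti + Lh * y t0).
    by do ! (apply: ler_enormD; rewrite ?Lf_lip ?Lg_lip ?Lh_lip//).
  have dzr : dz r = Lf * z r + K by rewrite /dz expgrowE// /z; ring.
  rewrite dzr /K /a; lra.
- by rewrite /z !subrr enorm0 expgrow0 mulr0.
Qed.

(** [xi_bar] is tuned so that the growth estimate reads [(LW * Lh + beta) * u <= beta * y t0];
    inserting [y t0 <= y s + u] cancels [beta * u]. *)
Lemma block_deviation l i s : (i < N l)%N -> t l i <= s < t l i.+1 ->
  LW * Lh * enorm (x s - x (t l 0%N)) <= beta * y s.
Proof.
move=> iN /andP[ts st]; set t0 := t l 0%N; set u := enorm _.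
have [_ _ _ tN] := t_seq.
have LWh : 0 < LW * Lh + beta by rewrite addr_gt0// mulr_gt0.
have D0 : 0 < L * (LW * Lh + beta) by rewrite mulr_gt0.
have uK : u <= L * y t0 * expgrow a (s - t0).
  apply: (@block_deviation_growth l i.+1) => //.
  rewrite (ltW st) andbT (le_trans _ ts)// (time_grid_mono t_seq)// ltnW//.
have Es : expgrow a (s - t0) <= beta / (L * (LW * Lh + beta)).
  have -> : beta / (L * (LW * Lh + beta)) = beta * a / (L * (LW * Lh + beta)) / a.
    by field; rewrite !gt_eqF.
  apply: expgrow_le_ln => //; first by rewrite addr_gt0// divr_gt0// mulr_gt0.
  apply: le_trans (block_len l); rewrite lerD2r tN (le_trans (ltW st))//.
  exact: (time_grid_mono t_seq).
have uy : u <= beta / (LW * Lh + beta) * y t0.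
  apply: (le_trans uK); rewrite -subr_ge0.
  have -> : beta / (LW * Lh + beta) * y t0 - L * y t0 * expgrow a (s - t0) =
     L * y t0 * (beta / (L * (LW * Lh + beta)) - expgrow a (s - t0)).
    by field; rewrite !gt_eqF.
  by rewrite mulr_ge0 ?subr_ge0// mulr_ge0// ltW.
have y0 : y t0 <= y s + u.
  by rewrite addrC /y (le_trans (enorm_distD _ (x s) _))// lerD// enormB.
have : (LW * Lh + beta) * u <= beta * y t0.
  by rewrite -ler_pdivlMl// mulrA [_^-1 * _]mulrC.
have := ler_wpM2l (ltW beta_gt0) y0.
lra.
Qed.

Let mu := (alpha - beta) ^+ 2 / (L * LW + alpha).
Let alpha_gt0 : 0 < alpha. Proof. exact: lt_trans beta_lt. Qed.
Let mu_gt0 : 0 < mu.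
Proof. by rewrite divr_gt0 ?exprn_gt0 ?subr_gt0// addr_gt0// mulr_gt0. Qed.

Lemma step_deviation l i s : (i < N l)%N -> t l i <= s < t l i.+1 ->
  LW * Lg * enorm (x s - x (t l i)) <= (alpha - beta - mu) * y s.
Proof.
move=> iN tis; have := block_deviation iN tis.
case/andP: tis => ts st.
set t0 := t l 0%N; set ti := t l i; set w := enorm _ => wy; set u := enorm _.
have al : 0 < alpha - beta by rewrite subr_gt0.
(* The denominator inside the logarithm of [zeta_bar]. *)
pose D := Lg * (L * LW + alpha) + (alpha - beta) * a.
have D1 : 0 < L * LW + alpha by rewrite addr_gt0// mulr_gt0.
have D0 : 0 < D by rewrite addr_gt0// mulr_gt0.
pose K := a * y ti + Lh * y t0.
have K0 : 0 <= K by rewrite addr_ge0// mulr_ge0 ?y_ge0// ltW.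
have Es : expgrow Lf (s - ti) <= (alpha - beta) / D.
  have -> : (alpha - beta) / D = Lf * (alpha - beta) / D / Lf.
    by field; rewrite !gt_eqF.
  apply: expgrow_le_ln => //; first by rewrite addr_gt0// divr_gt0// mulr_gt0.
  by apply: le_trans (step_len iN); rewrite lerD2r ltW.
have uK : D * u <= (alpha - beta) * K.
  have : u <= K * ((alpha - beta) / D).
    apply: (le_trans (step_deviation_growth iN _)); first by rewrite ts ltW.
    by rewrite ler_wpM2l.
  by rewrite -(ler_pM2l D0) => /le_trans; apply; rewrite le_eqVlt; apply/orP; left;
    apply/eqP; field; rewrite gt_eqF.
have yi : y ti <= y s + u.
  by rewrite addrC /y (le_trans (enorm_distD _ (x s) _))// lerD// enormB.
have y0 : y t0 <= y s + w.
  by rewrite addrC /y (le_trans (enorm_distD _ (x s) _))// lerD// enormB.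
have H1 : (alpha - beta) * (a * y ti) <= (alpha - beta) * (a * (y s + u)).
  by rewrite !ler_pM2l.
have H2 : LW * (Lh * y t0) <= LW * (Lh * (y s + w)) by rewrite !ler_pM2l.
(* Replacing [y ti] by [y s + u] produces a term [(alpha - beta) * a * u], which the second summand
   of [D] cancels. *)
have H3 : Lg * (L * LW + alpha) * u <= (alpha - beta) * (a * y s + Lh * y t0).
  by move: uK; rewrite /D /K; lra.
(* [block_deviation] trades [LW * Lh * y t0] for [(LW * Lh + beta) * y s]. Dividing by
   [L * LW + alpha] then leaves exactly the factor [alpha - beta - mu]. *)
have H4 : (L * LW + alpha) * (LW * Lg * u) <= (alpha - beta) * (L * LW + beta) * y s.
  have : LW * (Lg * (L * LW + alpha) * u) <= LW * ((alpha - beta) * (a * y s + Lh * y t0)).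
    by rewrite ler_pM2l.
  have : (alpha - beta) * (LW * (Lh * y t0)) <= (alpha - beta) * (LW * Lh * y s + beta * y s).
    by rewrite ler_pM2l//; lra.
  rewrite /L /a; lra.
rewrite -(ler_pM2l D1) (le_trans H4)// le_eqVlt; apply/orP; left; apply/eqP.
by rewrite /mu; field; rewrite gt_eqF.
Qed.

(** The quadratic bounds give [W xbar <= 0] and [0 <= W z] on the ball, so [xbar] is a local
    minimum. *)
Let grad_xbar : grad W xbar = 0.
Proof.
apply: (grad_local_min rad_gt0 (W_diff _)) => z /ltW zr; split => //.
have [Wz _ _] := W_ball zr.
have [|_ Wx _] := @W_ball xbar; first by rewrite subrr enorm0 ltW.
rewrite subrr enorm0 expr0n mulr0 in Wx.
rewrite (le_trans Wx)// (le_trans _ Wz)// mulr_ge0 ?sqr_ge0// mulr_ge0 ?invr_ge0//.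
exact: ltW.
Qed.

Let grad_le z : enorm (grad W z) <= LW * enorm (z - xbar).
Proof. by have := LW_lip z xbar; rewrite grad_xbar subr0. Qed.

Lemma lyapunov_derivative l i s : (i < N l)%N -> t l i <= s < t l i.+1 ->
  y s <= rad ->
  ((grad W (x s))^T *m (f (x s) + g (x (t l i)) + h (x (t l 0%N)))) 0 0 <=
  - mu * y s ^+ 2.
Proof.
move=> iN tis yr; have b1 := block_deviation iN tis; have b2 := step_deviation iN tis.
have [_ _ Wd] := W_ball yr.
set xi_ := x (t l i) in b2 *; set x0 := x (t l 0%N) in b1 *.
have -> : f (x s) + g xi_ + h x0 = (f (x s) + g (x s) + h (x s)) +
    ((g xi_ - g (x s)) + (h x0 - h (x s))).
  by apply/matrixP => ? ?; rewrite !mxE; ring.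
rewrite mulmxDr mxE; set p := (X in X + _).
have pert : ((grad W (x s))^T *m ((g xi_ - g (x s)) + (h x0 - h (x s)))) 0 0 <=
    (LW * y s) * (Lg * enorm (x s - xi_) + Lh * enorm (x s - x0)).
  apply: (le_trans (enorm_dot _ _)); rewrite ler_pM ?enorm_ge0//.
  by apply: ler_enormD; rewrite (enormB (x s)) ?Lg_lip ?Lh_lip.
have := ler_wpM2l (y_ge0 s) b1; have := ler_wpM2l (y_ge0 s) b2.
have : p <= - alpha * y s ^+ 2 by exact: Wd.
lra.
Qed.

(** Taking [c = 0] gives monotonicity of [W] along the solution; a positive [c] gives a definite
    rate while the state stays away from [xbar]. *)
Lemma lyapunov_decrease p q c : 0 <= p -> p <= q ->
  (forall s, p <= s <= q -> y s <= rad) ->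
  (forall s, p <= s <= q -> c <= mu * y s ^+ 2) ->
  W (x q) + c * (q - p) <= W (x p).
Proof.
move=> p0 pq yr cy.
suff : W (x q) + c * q <= W (x p) + c * p by lra.
pose C := LW * rad + `|c|.
apply: (@abs_continuous_dini_le _ _ x (fun s => W (x s) + c * s) p q C) => //.
- exact: x_ac.
- move=> r s pr rs sq.
  rewrite opprD addrACA -mulrBr (le_trans (ler_normD _ _))//.
  have H1 : `|W (x s) - W (x r)| <= LW * rad * enorm (x s - x r).
    (* The ball is convex, so the gradient is at most [LW * rad] on the whole chord from [x r] to
       [x s]. *)
    apply: grad_bound_lipschitz => // e /andP[e0 e1].
    apply: (le_trans (grad_le _)); rewrite ler_pM2l//.
    have -> : x r + e *: (x s - x r) - xbar =
        (1 - e) *: (x r - xbar) + e *: (x s - xbar).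
      by apply/matrixP => ? ?; rewrite !mxE; ring.
    have -> : rad = (1 - e) * rad + e * rad by ring.
    apply: ler_enormD; rewrite enormZ ger0_norm ?subr_ge0// ler_wpM2l ?subr_ge0//.
      by apply: yr; rewrite pr (le_trans rs).
    by apply: yr; rewrite sq (le_trans pr).
  have sr : 0 <= s - r by rewrite subr_ge0.
  rewrite normrM (ger0_norm sr) /C.
  have : 0 <= LW * rad * (s - r) by rewrite mulr_ge0// ltW// mulr_gt0.
  have : 0 <= `|c| * enorm (x s - x r) by rewrite mulr_ge0 ?enorm_ge0.
  lra.
have [_] := x_sol; apply: ae_lebesgueS => s H /andP[ps sq] e e0.
have s0 : 0 <= s by rewrite (le_trans p0)// ltW.
have spq : p <= s <= q by rewrite (ltW ps) (ltW sq).
have [l [i [iN tis]]] := time_grid_cover t_seq xi_gt0 block_len_ge s0.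
have dx := H s0 l i iN tis.
have dW := is_derive_comp_grad dx (W_diff _).
have dc : is_derive s (1 : R) (fun s => W (x s) + c * s)
   (((grad W (x s))^T *m (f (x s) + g (x (t l i)) + h (x (t l 0%N)))) 0 0 + c).
  have -> : (fun s => W (x s) + c * s) = (W \o x) + (c \*: id) by exact/funext.
  by apply: is_derive_eq; rewrite /GRing.scale /= mulr1.
apply: (is_derive_dini dc); apply: le_lt_trans e0.
have := lyapunov_derivative iN tis (yr _ spq); have := cy _ spq; lra.
Qed.

(* Hop along [0, T] with steps on which [x] moves by less than [r]: on the next
   hop the state stays within [2 r <= rad], where [W] decreases, which brings it
   back within [r]. *)
Lemma sublevel_invariant r s : 0 < r -> 2 * r <= rad ->
  y 0 < Num.min 1 (c1 / c2) * r -> 0 <= s -> y s < r.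
Proof.
move=> r0 rr y0 s0; set kap := Num.min 1 _ in y0.
have kap0 : 0 < kap by rewrite lt_min ltr01 divr_gt0.
have kap1 : kap <= 1 by rewrite ge_min lexx.
have kapc : c2 * kap ^+ 2 <= c1.
  have : c2 * kap <= c1 by rewrite mulrC -ler_pdivlMr// ge_min lexx orbT.
  have : c2 * kap ^+ 2 <= c2 * kap.
    by rewrite ler_pM2l// expr2 ler_piMr// ltW.
  lra.
have y0r : y 0 < r by rewrite (lt_le_trans y0)// ler_piMl// ltW.
have [d d0 H] := abs_continuous_uniform (x_ac s (lexx 0)) r0.
have d2 : 0 < d / 2 by rewrite divr_gt0.
have hop n : forall u, 0 <= u <= s -> u <= n%:R * (d / 2) -> y u < r.
  elim: n => [|n IH] u /andP[u0 us] un.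
    by have -> // : u = 0; apply: le_anti; rewrite u0 andbT; move: un; rewrite mul0r.
  have ball v : 0 <= v <= u -> y v <= rad.
    move=> /andP[v0 vu]; apply: le_trans rr; rewrite mulr_natl mulr2n.
    have [vd|vd] := leP v (d / 2).
      rewrite /y (le_trans (enorm_distD _ (x 0) _))// lerD ?(ltW y0r)//.
      by apply/ltW/H => //; lra.
    rewrite /y (le_trans (enorm_distD _ (x (v - d / 2)) _))// lerD//.
      by apply/ltW/H; lra.
    by apply/ltW/IH; [lra | move: un; rewrite -[n.+1%:R]natr1; lra].
  have := @lyapunov_decrease 0 u 0 (lexx 0) u0 ball.
  rewrite mul0r addr0 => dec.
  have {}dec : W (x u) <= W (x 0).
    by apply: dec => v _; rewrite mulr_ge0 ?sqr_ge0// ltW.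
  have [Wu _ _] := W_ball (ball u ltac:(by rewrite u0 lexx)).
  have [_ W0 _] := W_ball (ball 0 ltac:(by rewrite u0 lexx)).
  rewrite -(ltr_pXn2r (n := 2))// ?nnegrE ?y_ge0// ?ltW//.
  have y02 : c2 * y 0 ^+ 2 < c2 * (kap * r) ^+ 2.
    by rewrite ltr_pM2l// ltr_pXn2r// ?nnegrE ?y_ge0// mulr_ge0// ltW.
  have : c2 * kap ^+ 2 * r ^+ 2 <= c1 * r ^+ 2 by rewrite ler_wpM2r ?sqr_ge0.
  rewrite -(ltr_pM2l c1_gt0) /y; rewrite /y in y02; lra.
apply: (hop (Num.truncn (s / (d / 2))).+1); first by rewrite s0 lexx.
by rewrite -ler_pdivrMr// ltW// truncnS_gt.
Qed.

(** The state never leaves the ball. If [W] stayed above a positive level it would decrease at a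
    fixed rate and violate that level in finite time; once below the level it remains there. *)
Lemma attraction : y 0 < Num.min 1 (c1 / c2) * (rad / 2) ->
  x s @[s --> +oo] --> xbar.
Proof.
move=> y0.
have inv s : 0 <= s -> y s <= rad.
  move=> s0; apply: (@le_trans _ _ (rad / 2)); last by have := rad_gt0; lra.
  apply/ltW/(sublevel_invariant _ _ y0 s0); first by rewrite divr_gt0.
  by rewrite mulrC divfK.
suff ev e : 0 < e -> exists2 T, 0 <= T & forall s, T <= s -> y s < e.
  apply/cvgrPdist_lt => e e0; have [T T0 yT] := ev e e0.
  exists T; split; first exact: num_real.
  move=> s /ltW /yT; apply: le_lt_trans.
  by rewrite distrC; exact: norm_le_enorm.
(* The lower bound of [W] at distance [e]: inside the ball, [W < w] forces [y < e]. *)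
move=> e0; pose w := 2^-1 * c1 * e ^+ 2.
have w0 : 0 < w by rewrite !mulr_gt0 ?exprn_gt0 ?invr_gt0.
have [T T0 WT] : exists2 T, 0 <= T & W (x T) < w.
  apply: contrapT => nT.
  have Ww s : 0 <= s -> w <= W (x s).
    by move=> s0; rewrite leNgt; apply/negP => sw; apply: nT; exists s.
  (* By the upper quadratic bound, [w <= W] forces [2 * w / c2 <= y ^+ 2]. *)
  pose c := mu * (2 * w / c2).
  have c0 : 0 < c by rewrite mulr_gt0// divr_gt0// mulr_gt0.
  (* By this time the decrease has used up [W (x 0)], so [W (x T)] would be nonpositive. *)
  pose T := W (x 0) / c.
  have W0 : 0 <= W (x 0) by rewrite (le_trans (ltW w0))// Ww.
  have T0 : 0 <= T by rewrite divr_ge0// ltW.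
  have : W (x T) + c * (T - 0) <= W (x 0).
    apply: lyapunov_decrease => // s /andP[s0 _]; first exact: inv.
    rewrite ler_pM2l// ler_pdivrMr//.
    have [_ Ws _] := W_ball (inv _ s0); have := Ww _ s0; rewrite /y; lra.
  have cT : c * T = W (x 0) by rewrite /T mulrC divfK ?gt_eqF.
  by have := Ww _ T0; rewrite subr0 cT; lra.
exists T => // s Ts; have s0 : 0 <= s by exact: le_trans Ts.
have dec : W (x s) <= W (x T).
  have := @lyapunov_decrease T s 0 T0 Ts; rewrite mul0r addr0; apply.
    by move=> u /andP[Tu _]; apply: inv; exact: le_trans Tu.
  by move=> u _; rewrite mulr_ge0 ?sqr_ge0// ltW.
have [Ws _ _] := W_ball (inv _ s0).
rewrite -(ltr_pXn2r (n := 2))// ?nnegrE ?y_ge0 ?ltW//.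
rewrite -(ltr_pM2l c1_gt0) /y; rewrite /w in WT; lra.
Qed.

End Solution.

Lemma sampled_locally_asymptotically_stable :
  locally_asymptotically_stable (tt_solution f g h N t) xbar.
Proof.
have kap0 : 0 < Num.min 1 (c1 / c2) by rewrite lt_min ltr01 divr_gt0.
have rad2 : 0 < rad / 2 by rewrite divr_gt0.
split => [r r0|].
  (* Capped because the invariance argument needs twice the radius to fit in the Lyapunov ball. *)
  pose r' := Num.min r (rad / 2).
  have r'0 : 0 < r' by rewrite lt_min r0.
  exists (Num.min 1 (c1 / c2) * r'); first by rewrite mulr_gt0.
  move=> x xs x0 s s0; apply: (@lt_le_trans _ _ r'); last by rewrite ge_min lexx.
  apply: (sublevel_invariant xs) => //.
  have : r' <= rad / 2 by rewrite ge_min lexx orbT.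
  lra.
exists (Num.min 1 (c1 / c2) * (rad / 2)); first by rewrite mulr_gt0.
by move=> x xs x0; exact: attraction.
Qed.

End SampledLyapunov.

(** * Application to the power network with bidding *)

Theorem theoremV1 (R : realType) (n m q : nat) (n_gt0 : (0 < n)%N)
  (S : bidding_network R n m) (xbar : 'cV[R]_(sdim n))
  (xbar_eq : Fvec S xbar = 0)
  (xbar_angle : forall k, - (pi / 2) < edge_angle S (st_phi xbar) k 0 < pi / 2)
  (gamma : R) (gamma_lb : mx_norm (edge_angle S (st_phi xbar)) < gamma)
  (gamma_ub : gamma < pi / 2)
  (B : 'M[R]_(sdim n, q))
  (e0 e1 e2 e3 : R) (e0_gt0 : 0 < e0) (e1_gt0 : 0 < e1) (e2_gt0 : 0 < e2)
  (e3_gt0 : 0 < e3)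
  (alpha chi c1 c2 : R) (alpha_gt0 : 0 < alpha) (chi_gt0 : 0 < chi)
  (c1_gt0 : 0 < c1) (c2_gt0 : 0 < c2)
  (W_ISS : forall (x : 'cV[R]_(sdim n)) (d : 'cV[R]_q),
     angle_domain S gamma x -> enorm d <= chi * enorm (x - xbar) ->
     [/\ 2^-1 * c1 * enorm (x - xbar) ^+ 2 <= Wfun S e0 e1 e2 e3 xbar x,
         Wfun S e0 e1 e2 e3 xbar x <= 2^-1 * c2 * enorm (x - xbar) ^+ 2
       & ((grad (Wfun S e0 e1 e2 e3 xbar) x)^T *m (Fvec S x + B *m d)) 0 0
         <= - alpha * enorm (x - xbar) ^+ 2])
  (Lf Lg Lh LW : R) (Lf_gt0 : 0 < Lf) (Lg_gt0 : 0 < Lg) (Lh_gt0 : 0 < Lh)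
  (LW_gt0 : 0 < LW)
  (Lf_lip : lipschitz_const Lf (fvec S)) (Lg_lip : lipschitz_const Lg (gvec S))
  (Lh_lip : lipschitz_const Lh (hvec S))
  (LW_lip : lipschitz_const LW (grad (Wfun S e0 e1 e2 e3 xbar)))
  (beta : R) (beta_gt0 : 0 < beta) (beta_lt : beta < alpha)
  (N : nat -> nat) (t : nat -> nat -> R) (t_seq : time_sequence N t)
  (zeta_lo xi_lo : R)
  (zeta_lo_bd : 0 < zeta_lo < zeta_bar Lf Lg Lh LW alpha beta)
  (xi_lo_bd : 0 < xi_lo < xi_bar Lf Lg Lh LW beta)
  (block_len : forall l : nat,
     xi_lo <= t l.+1 0%N - t l 0%N <= xi_bar Lf Lg Lh LW beta)
  (step_len : forall l k : nat, (1 <= k <= N l)%N ->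
     zeta_lo <= t l k - t l k.-1 <= zeta_bar Lf Lg Lh LW alpha beta) :
  locally_asymptotically_stable
    (tt_solution (fvec S) (gvec S) (hvec S) N t) xbar.
Proof.
have [rad rad0 rad_ball] := angle_domain_ball gamma_lb.
have xi_lo_gt0 : 0 < xi_lo by case/andP: xi_lo_bd.
have block_ge l : xi_lo <= t l.+1 0%N - t l 0%N by case/andP: (block_len l).
have block_le l : t l.+1 0%N - t l 0%N <= xi_bar Lf Lg Lh LW beta.
  by case/andP: (block_len l).
have step_le l i : (i < N l)%N -> t l i.+1 - t l i <= zeta_bar Lf Lg Lh LW alpha beta.
  by move=> iN; case/andP: (step_len l i.+1 iN).
apply: (sampled_locally_asymptotically_stable xbar_eq Lf_gt0 Lg_gt0 Lh_gt0 LW_gt0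
  Lf_lip Lg_lip Lh_lip LW_lip beta_gt0 beta_lt t_seq block_le step_le
  xi_lo_gt0 block_ge rad0 c1_gt0 c2_gt0); first exact: Wfun_differentiable.
(* The dissipation inequality is taken at the zero disturbance, on a ball contained in the angle
   domain. *)
move=> z /rad_ball zD; have [|Wlo Whi] := W_ISS z 0 zD.
  by rewrite enorm0 mulr_ge0 ?enorm_ge0// ltW.
by rewrite mulmx0 addr0.
Qed.
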